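(* Let $(\alpha_1,\alpha_2,\phi,g)$ be a metric contact pair of type $(h,k)$ with decomposable $\phi$ on a $(2h+2k+2)$-dimensional manifold $M$, with Reeb vector fields $Z_1,Z_2$, and let $Z=Z_1+Z_2$. Let $\mathrm{h}=\frac12\mathcal{L}_Z\phi$ (an endomorphism field, not to be confused with the integer $h$). Then $$\mathrm{Ric}(Z)=h+k-\tfrac12\,\mathrm{Tr}\,\mathrm{h}^2 .$$ Moreover $\mathrm{Ric}(Z)=h+k$ if and only if $Z$ is Killing.
   Context: All objects are smooth. The exterior derivative of a 1-form is normalized by $2\,d\alpha(X,Y)=X\alpha(Y)-Y\alpha(X)-\alpha([X,Y])$. Contact pair of type $(h,k)$ ($h,k\ge 0$ integers) on a $(2h+2k+2)$-dimensional manifold $M$: a pair of 1-forms $(\alpha_1,\alpha_2)$ such that $\alpha_1\wedge(d\alpha_1)^h\wedge\alpha_2\wedge(d\alpha_2)^k$ is a volume form, $(d\alpha_1)^{h+1}=0$ and $(d\alpha_2)^{k+1}=0$. The Reeb vector fields $Z_1,Z_2$ are the unique vector fields with $\alpha_i(Z_j)=\delta_{ij}$ and $i_{Z_j}d\alpha_i=0$ for all $i,j\in\{1,2\}$. The distribution $T\mathcal{F}_i=\ker\alpha_i\cap\ker d\alpha_i$ is integrable and defines the characteristic foliation $\mathcal{F}_i$ of $\alpha_i$; $TM=T\mathcal{F}_1\oplus T\mathcal{F}_2$. A contact pair structure $(\alpha_1,\alpha_2,\phi)$ consists of a contact pair and a $(1,1)$-tensor field $\phi$ with $\phi^2=-\mathrm{Id}+\alpha_1\otimes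 Z_1+\alpha_2\otimes Z_2$ and $\phi Z_1=\phi Z_2=0$. The tensor $\phi$ is decomposable if $\phi(T\mathcal{F}_i)\subset T\mathcal{F}_i$ for $i=1,2$. A Riemannian metric $g$ is associated if $g(X,\phi Y)=(d\alpha_1+d\alpha_2)(X,Y)$ and $g(X,Z_i)=\alpha_i(X)$ for $i=1,2$ and all vector fields $X,Y$. A metric contact pair is a quadruple $(\alpha_1,\alpha_2,\phi,g)$ with $(\alpha_1,\alpha_2,\phi)$ a contact pair structure and $g$ an associated metric. $\mathcal{L}_Z$ is the Lie derivative along $Z$. $\mathrm{Ric}(Z)$ denotes the Ricci curvature of $g$ in the direction of $Z$, i.e. the sum of the sectional curvatures $K(Z,e_j)$ over an orthonormal basis $(e_j)$ of the orthogonal complement of $Z$; equivalently it is the Ricci tensor evaluated twice on the unit vector $Z/|Z|$, where $|Z|^2=g(Z,Z)=2$. *)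

(* Defs.v *)
From mathcomp Require Import all_boot all_order all_algebra all_fingroup.
From mathcomp Require Import all_classical all_reals all_analysis.
Import Order.TTheory GRing.Theory Num.Theory.
Import numFieldNormedType.Exports.

Set Implicit Arguments.
Unset Strict Implicit.
Unset Printing Implicit Defensive.

Local Open Scope classical_set_scope.
Local Open Scope ring_scope.

(* Tangent vectors are row vectors.  A linear map acts on them from the right,
   as in MathComp's [jacobian]: f(v) = v *m A. *)

Section SmoothMaps.
Variables (R : realType) (V W : normedModType R).

Fixpoint times_differentiable (m : nat) (U : set V) (f : V -> W) : Prop :=
  if m is m'.+1 then
    (forall x, U x -> differentiable f x) /\
    (forall v, times_differentiable m' U (fun x => 'D_v f x))
  else True.

(* Meaningful for open U, the only case used below. *)
Definition smooth_on (U : set V) (f : V -> W) : Prop :=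
  forall m, times_differentiable m U f.

End SmoothMaps.

Record manifold (R : realType) (n : nat) := Manifold {
  carrier :> topologicalType;
  chart : Type;
  chart_dom : chart -> set carrier;
  coord : chart -> carrier -> 'rV[R]_n;
  coordV : chart -> 'rV[R]_n -> carrier;
  manifold_hausdorff : hausdorff_space carrier;
  manifold_countable : @second_countable carrier;
  dom_open : forall a, open (chart_dom a);
  dom_cover : forall p, exists a, chart_dom a p;
  coordK : forall a p, chart_dom a p -> coordV a (coord a p) = p;
  coord_open : forall a, open (coord a @` chart_dom a);
  coord_continuous : forall a p, chart_dom a p -> {for p, continuous (coord a)};
  coordV_continuous : forall a x, (coord a @` chart_dom a) x ->
    {for x, continuous (coordV a)};
  transition_smooth : forall a b,
    smooth_on (coord a @` (chart_dom a `&` chart_dom b)) (coord b \o coordV a)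
}.

Section Tensors.
Variables (R : realType) (n : nat) (M : manifold R n).
Local Notation E := 'rV[R]_n.

(* A tensor field is the family, indexed by the charts a, of its components in
   the chart a, as functions of the point p of M.  Only the values at points of
   the domain of a matter. *)

Definition jac (a b : chart M) (p : M) : 'M[R]_n :=
  jacobian (coord b \o coordV a) (coord a p).

Definition smooth_in (W : normedModType R) (a : chart M) (F : M -> W) : Prop :=
  smooth_on (coord a @` chart_dom a) (F \o coordV a).

Definition vector_field (X : chart M -> M -> E) : Prop :=
  (forall a, smooth_in a (X a)) /\
  (forall a b p, chart_dom a p -> chart_dom b p -> X b p = X a p *m jac a b p).

Definition one_form (al : chart M -> M -> 'cV[R]_n) : Prop :=
  (forall a, smooth_in a (al a)) /\
  (forall a b p, chart_dom a p -> chart_dom b p ->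
     al a p = jac a b p *m al b p).

Definition endo_field (phi : chart M -> M -> 'M[R]_n) : Prop :=
  (forall a, smooth_in a (phi a)) /\
  (forall a b p, chart_dom a p -> chart_dom b p ->
     phi a p *m jac a b p = jac a b p *m phi b p).

Definition pair1 (al : 'cV[R]_n) (u : E) : R := (u *m al) 0 0.
Definition pair2 (g : 'M[R]_n) (u v : E) : R := (u *m g *m v^T) 0 0.

Definition riemannian_metric (g : chart M -> M -> 'M[R]_n) : Prop :=
  [/\ forall a, smooth_in a (g a),
      forall a b p, chart_dom a p -> chart_dom b p ->
        g a p = jac a b p *m g b p *m (jac a b p)^T,
      forall a p, chart_dom a p -> forall u v,
        pair2 (g a p) u v = pair2 (g a p) v u
    & forall a p, chart_dom a p -> forall u, u != 0 -> 0 < pair2 (g a p) u u].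

(* Differential operators in a chart a, on vector fields X, Y : M -> E given by
   their components in a. *)

Definition dd (W : normedModType R) (a : chart M) (F : M -> W) (p : M)
  (v : E) : W := 'D_v (F \o coordV a) (coord a p).

Definition bracket (a : chart M) (X Y : M -> E) (p : M) : E :=
  dd a Y p (X p) - dd a X p (Y p).

(* The values at p of the tensors below are computed on the extensions of
   tangent vectors u, v, w at p with constant components, [cst u] etc. *)

(* 2 dal(X,Y) = X al(Y) - Y al(X) - al([X,Y]) *)
Definition ext_d (al : chart M -> M -> 'cV[R]_n) (a : chart M) (p : M)
  (u v : E) : R :=
  let X := cst u in let Y := cst v in
  2^-1 * (dd a (fun q => pair1 (al a q) (Y q)) p (X p)
          - dd a (fun q => pair1 (al a q) (X q)) p (Y p)
          - pair1 (al a p) (bracket a X Y p)).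

(* (L_Z phi) X = [Z, phi X] - phi [Z, X] *)
Definition lie_endo (Z : chart M -> M -> E) (phi : chart M -> M -> 'M[R]_n)
  (a : chart M) (p : M) : 'M[R]_n :=
  lin1_mx (fun u : E => let X := cst u in
    bracket a (Z a) (fun q => X q *m phi a q) p
    - bracket a (Z a) X p *m phi a p).

(* (L_Z g)(X, Y) = Z g(X, Y) - g([Z, X], Y) - g(X, [Z, Y]) *)
Definition lie_metric (Z : chart M -> M -> E) (g : chart M -> M -> 'M[R]_n)
  (a : chart M) (p : M) (u v : E) : R :=
  let X := cst u in let Y := cst v in
  dd a (fun q => pair2 (g a q) (X q) (Y q)) p (Z a p)
  - pair2 (g a p) (bracket a (Z a) X p) (Y p)
  - pair2 (g a p) (X p) (bracket a (Z a) Y p).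

Definition killing (g : chart M -> M -> 'M[R]_n) (Z : chart M -> M -> E) :=
  forall a p, chart_dom a p -> forall u v, lie_metric Z g a p u v = 0.

(* Christoffel symbols of the Levi-Civita connection: christoffel u v is the
   vector with, for all w,
   2 g(christoffel u v, w) = D_u g(v, w) + D_v g(u, w) - D_w g(u, v). *)
Definition christoffel (g : chart M -> M -> 'M[R]_n) (a : chart M) (p : M)
  (u v : E) : E :=
  let dg (x y z : E) := dd a (fun q => pair2 (g a q) y z) p x in
  (\row_l (let w := delta_mx 0 l in
           2^-1 * (dg u v w + dg v u w - dg w u v))) *m invmx (g a p).

Definition nabla (g : chart M -> M -> 'M[R]_n) (a : chart M) (X Y : M -> E)
  (p : M) : E := dd a Y p (X p) + christoffel g a p (X p) (Y p).

(* R(X,Y)W = nabla_X nabla_Y W - nabla_Y nabla_X W - nabla_[X,Y] W *)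
Definition riemann (g : chart M -> M -> 'M[R]_n) (a : chart M) (p : M)
  (u v w : E) : E :=
  let X := cst u in let Y := cst v in let W := cst w in
  nabla g a X (nabla g a Y W) p - nabla g a Y (nabla g a X W) p
  - nabla g a (bracket a X Y) W p.

Definition sectional (g : chart M -> M -> 'M[R]_n) (a : chart M) (p : M)
  (u v : E) : R :=
  pair2 (g a p) (riemann g a p u v v) u /
  (pair2 (g a p) u u * pair2 (g a p) v v - pair2 (g a p) u v ^+ 2).

(* n - 1 vectors, hence a basis of the orthogonal complement of u != 0 *)
Definition orthonormal_complement (g : chart M -> M -> 'M[R]_n) (a : chart M)
  (p : M) (u : E) (e : 'I_n.-1 -> E) : Prop :=
  (forall i j, pair2 (g a p) (e i) (e j) = (i == j)%:R) /\
  (forall i, pair2 (g a p) u (e i) = 0).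

Definition ricci_direction (g : chart M -> M -> 'M[R]_n) (a : chart M) (p : M)
  (u : E) (e : 'I_n.-1 -> E) : R := \sum_j sectional g a p u (e j).

End Tensors.

Section Wedge.
Variables (R : realType) (n : nat).

Definition kform (r : nat) := ('I_r -> 'rV[R]_n) -> R.

(* The normalization 1/(r+s)! is the one matching that of [ext_d]. *)
Definition wedge (r s : nat) (x : kform r) (y : kform s) : kform (r + s) :=
  fun v => ((r + s)`!%:R)^-1 * \sum_(t : 'S_(r + s)) (-1) ^+ t *
    (x (fun i => v (t (lshift s i))) * y (fun j => v (t (rshift r j)))).

Fixpoint wedge_pow (w : kform 2) (m : nat) : kform (m * 2) :=
  if m is m'.+1 then wedge w (@wedge_pow w m') else fun=> 1.

Definition form1 (al : 'cV[R]_n) : kform 1 := fun v => pair1 al (v ord0).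
Definition form2 (w : 'rV[R]_n -> 'rV[R]_n -> R) : kform 2 :=
  fun v => w (v ord0) (v ord_max).

End Wedge.
Arguments wedge_pow {R n} w m _ : assert.

Section ContactPairs.
Variables (R : realType) (h k : nat) (M : manifold R (2 * h + 2 * k + 2)).
Local Notation N := (2 * h + 2 * k + 2)%N.
Local Notation E := 'rV[R]_N.
Implicit Types (al : chart M -> M -> 'cV[R]_N).
Implicit Types (Z : chart M -> M -> E).
Implicit Types (phi g : chart M -> M -> 'M[R]_N).

Definition contact_pair al1 al2 : Prop :=
  [/\ one_form al1, one_form al2 &
   forall a p, chart_dom a p ->
     let dal1 := form2 (ext_d al1 a p) in
     let dal2 := form2 (ext_d al2 a p) in
     [/\ exists v, wedge (wedge (wedge (form1 (al1 a p)) (wedge_pow dal1 h))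
                                (form1 (al2 a p))) (wedge_pow dal2 k) v != 0,
         forall v, wedge_pow dal1 h.+1 v = 0
       & forall v, wedge_pow dal2 k.+1 v = 0]].

Definition reeb_fields al1 al2 Z1 Z2 : Prop :=
  [/\ vector_field Z1, vector_field Z2 &
   forall a p, chart_dom a p ->
   [/\ [/\ pair1 (al1 a p) (Z1 a p) = 1, pair1 (al1 a p) (Z2 a p) = 0,
           pair1 (al2 a p) (Z1 a p) = 0 & pair1 (al2 a p) (Z2 a p) = 1],
       forall u, ext_d al1 a p (Z1 a p) u = 0,
       forall u, ext_d al1 a p (Z2 a p) u = 0,
       forall u, ext_d al2 a p (Z1 a p) u = 0
     & forall u, ext_d al2 a p (Z2 a p) u = 0]].

Definition contact_pair_structure al1 al2 Z1 Z2 phi : Prop :=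
  [/\ contact_pair al1 al2, reeb_fields al1 al2 Z1 Z2, endo_field phi &
   forall a p, chart_dom a p ->
   [/\ forall u : E, u *m phi a p *m phi a p =
         - u + pair1 (al1 a p) u *: Z1 a p + pair1 (al2 a p) u *: Z2 a p,
       Z1 a p *m phi a p = 0 & Z2 a p *m phi a p = 0]].

(* T F = ker al /\ ker d al *)
Definition characteristic (al : chart M -> M -> 'cV[R]_N) (a : chart M) (p : M)
  : set E :=
  [set u | pair1 (al a p) u = 0 /\ forall v, ext_d al a p u v = 0].

Definition decomposable al1 al2 phi : Prop :=
  forall a p, chart_dom a p -> forall u,
    (characteristic al1 a p u -> characteristic al1 a p (u *m phi a p)) /\
    (characteristic al2 a p u -> characteristic al2 a p (u *m phi a p)).

Definition associated al1 al2 Z1 Z2 phi g : Prop :=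
  riemannian_metric g /\
  forall a p, chart_dom a p ->
  [/\ forall u v : E, pair2 (g a p) u (v *m phi a p) =
        ext_d al1 a p u v + ext_d al2 a p u v,
      forall u, pair2 (g a p) u (Z1 a p) = pair1 (al1 a p) u
    & forall u, pair2 (g a p) u (Z2 a p) = pair1 (al2 a p) u].

Definition metric_contact_pair al1 al2 Z1 Z2 phi g : Prop :=
  contact_pair_structure al1 al2 Z1 Z2 phi /\
  associated al1 al2 Z1 Z2 phi g.

End ContactPairs.

(* Main.v *)
Require Import Defs.
From mathcomp Require Import all_boot all_order all_algebra all_fingroup.
From mathcomp Require Import all_classical all_reals all_analysis.
From mathcomp Require Import ring.
Import Order.TTheory GRing.Theory Num.Theory.
Import numFieldNormedType.Exports.
Local Open Scope classical_set_scope.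
Local Open Scope ring_scope.

Set Implicit Arguments.
Unset Strict Implicit.
Unset Printing Implicit Defensive.

(** Everything is local, so fix a chart and let A v = nabla_v Z.  Since
    Z = Z1 + Z2 has constant length and i_Z d(al1 + al2) = 0, the Koszul formula
    gives A = S - phi, where 2 g(S u, v) = (L_Z g)(u, v); in particular
    A Z = nabla_Z Z = 0.  Differentiating A Z = 0 yields the Riccati equation
    R(Z, .)Z = nabla_Z A + A^2, hence Ric(Z, Z) = - tr A^2 once tr A = 0.
    By Cartan's formula Z preserves al1, al2, their differentials, Z1 and Z2.
    Applying L_Z to d(al1 + al2) = g(., phi .) gives h = - phi S, and applying
    it to phi^2 gives phi h + h phi = 0, so phi S phi = S.  Therefore tr S = 0,
    tr h^2 = tr S^2 and tr A^2 = tr S^2 + tr phi^2 = tr h^2 - 2 (h + k).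
    As |Z|^2 = 2 this is the formula for Ric(Z).  Since S is g-symmetric,
    tr S^2 = 0 forces S = 0, that is L_Z g = 0. *)

(** Products of endomorphisms above are in matrix order: vectors are rows multiplied from the left,
    so [phi S] applies phi first. The skew part of nabla Z is half the usual exterior derivative of
    the metric dual al1 + al2 of Z; in the present normalization it is d(al1 + al2) itself, that is
    g(., phi .), and skewness of phi gives the sign in A = S - phi. The value tr phi^2 = - 2 (h + k)
    comes from phi^2 being - Id plus two rank-one projections, in dimension 2h + 2k + 2. The term
    nabla_Z A has no trace because tr (nabla_Z A) = Z (tr A), so tr A = 0 must be known on a whole
    open set and not at one point only. For the same reason every structural identity is stated on
    the open image of a chart and differentiated there. What then remains at a single point is
    isolated in lemmas named [_alg], where Jacobians and derivatives are mere letters. *)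

(* [coord] alone would be the coordinate map of [vector]. *)
Local Notation coord := Defs.coord.

(** * Symmetry of second derivatives *)

Section Schwarz.
Context {R : realType} {V : normedModType R}.

(** Restricts to a line, so that the one-variable mean value theorem applies to directional
    derivatives. *)
Lemma is_derive_line (W : normedModType R) (f : V -> W) (p u : V) (s : R) :
  derivable f (p + s *: u) u ->
  is_derive s 1 (fun t => f (p + t *: u)) ('D_u f (p + s *: u)).
Proof.
have E : (fun h : R => h^-1 *: (((fun t => f (p + t *: u)) \o shift s) (h *: 1)
            - f (p + s *: u))) =
         (fun h => h^-1 *: ((f \o shift (p + s *: u)) (h *: u)
            - f (p + s *: u))).
  apply/funext => h /=; congr (_ *: (f _ - _)).
  by rewrite [h *: 1]mulr1 scalerDl addrCA.
by move=> df; split; rewrite /derivable /derive E.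
Qed.

(** The mean value theorem is used along [u] on the increment of [f] by [t *: v], then along [v] on
    ['D_u f]. The second difference on the left is symmetric in [u] and [v], which is what makes the
    lemma useful. *)
Lemma mixed_difference (f : V -> R) (x u v : V) (t : R) : 0 < t ->
  (forall r s : R, 0 <= r <= t -> 0 <= s <= t ->
     let y := x + r *: u + s *: v in
     derivable f y u /\ derivable ('D_u f) y v) ->
  exists2 rs : R * R, (0 <= rs.1 <= t) && (0 <= rs.2 <= t) &
    f (x + t *: u + t *: v) - f (x + t *: v) - (f (x + t *: u) - f x) =
      'D_v ('D_u f) (x + rs.1 *: u + rs.2 *: v) * t * t.
Proof.
move=> t0 df.
pose F r := f (x + t *: v + r *: u) - f (x + r *: u).
pose dF r := 'D_u f (x + t *: v + r *: u) - 'D_u f (x + r *: u).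
have tt : 0 <= t <= t by rewrite lexx (ltW t0).
have zt : 0 <= (0 : R) <= t by rewrite lexx (ltW t0).
have FdF (r : R) : 0 <= r <= t -> is_derive r 1 F (dF r).
  move=> rt; apply: is_deriveB; apply: is_derive_line.
    by rewrite addrAC; have [] := df r t rt tt.
  by have [] := df r 0 rt zt; rewrite scale0r addr0.
have [||r rin FE] := MVT t0 (f := F) (df := dF).
- by move=> r; rewrite in_itv /= => /andP[? ?]; apply: FdF; rewrite !ltW.
- apply: derivable_within_continuous => r; rewrite in_itv /= => rt.
  exact: (@ex_derive _ _ _ _ _ _ _ (FdF r rt)).
have rt : 0 <= r <= t.
  by move: rin; rewrite in_itv /= => /andP[? ?]; rewrite !ltW.
pose G s := 'D_u f (x + r *: u + s *: v).
have GdG (s : R) : 0 <= s <= t ->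
    is_derive s 1 G ('D_v ('D_u f) (x + r *: u + s *: v)).
  by move=> st; apply: is_derive_line; have [] := df r s rt st.
have [||s sin GE] := MVT t0 (f := G)
    (df := fun s => 'D_v ('D_u f) (x + r *: u + s *: v)).
- by move=> s; rewrite in_itv /= => /andP[? ?]; apply: GdG; rewrite !ltW.
- apply: derivable_within_continuous => s; rewrite in_itv /= => st.
  exact: (@ex_derive _ _ _ _ _ _ _ (GdG s st)).
exists (r, s) => /=.
  by rewrite rt; move: sin; rewrite in_itv /= => /andP[? ?]; rewrite !ltW.
move: FE GE; rewrite /F /dF /G !scale0r !addr0 !subr0 => FE GE.
rewrite -GE (addrAC x (r *: u)) -FE (addrAC x (t *: u)); ring.
Qed.

(** The same second difference is [t * t] times a value of either mixed derivative inside a small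
    parallelogram at [x]; by continuity both values are within [e / 2] of those at [x]. *)
Lemma derive_comm (f : V -> R) (U : set V) (x u v : V) : open U -> U x ->
  (forall y, U y -> [/\ derivable f y u, derivable f y v,
      derivable ('D_u f) y v & derivable ('D_v f) y u]) ->
  {for x, continuous ('D_v ('D_u f))} -> {for x, continuous ('D_u ('D_v f))} ->
  'D_v ('D_u f) x = 'D_u ('D_v f) x.
Proof.
move=> oU Ux df cvu cuv; apply/eqP; rewrite -subr_eq0 -normr_le0.
apply/ler_addgt0Pl => e e0; rewrite addr0.
have e2 : 0 < e / 2 by rewrite divr_gt0.
have nU : nbhs x U by apply: open_nbhs_nbhs.
have n1 := (cvgrPdist_lt _ _).1 cvu _ e2.
have n2 := (cvgrPdist_lt _ _).1 cuv _ e2.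
have nn : nbhs x (U `&`
    ((fun y => `|'D_v ('D_u f) x - 'D_v ('D_u f) y| < e / 2) `&`
     (fun y => `|'D_u ('D_v f) x - 'D_u ('D_v f) y| < e / 2))).
  exact: filterI nU (filterI (n1 _) (n2 _)).
have [d /= d0 bd] := (nbhs_ballP _ _).1 nn.
(* Scales [t] so that the parallelogram with sides [t *: u] and [t *: v] stays in the ball of radius
   [d]; the summand 1 keeps [c] positive even if both vectors vanish. *)
pose c := `|u| + `|v| + 1.
have c0 : 0 < c by rewrite ltr_wpDl ?addr_ge0.
pose t := d / 2 / c.
have t0 : 0 < t by rewrite !divr_gt0.
have inb (r s : R) : 0 <= r <= t -> 0 <= s <= t ->
    ball x d (x + r *: u + s *: v).
  move=> /andP[r0 rt] /andP[s0 st]; rewrite -ball_normE /= -addrA opprD addNKr.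
  rewrite normrN (le_lt_trans (ler_normD _ _))// !normrZ !ger0_norm//.
  have : r * `|u| + s * `|v| <= t * c.
    rewrite /c !mulrDr mulr1 -addrA lerD ?ler_wpM2r//.
    by rewrite ler_wpDr ?ler_wpM2r // ltW.
  move/le_lt_trans; apply; rewrite /t divfK ?gt_eqF// ltr_pdivrMr//.
  by rewrite ltr_pMr// ltr1n.
have [|rs /andP[r1 r2] E1] := @mixed_difference f x u v t t0.
  by move=> r s rt st /=; have [/df[]] := bd _ (inb r s rt st).
have [_ [b1 _]] := bd _ (inb _ _ r1 r2).
have [|sr /andP[s1 s2] E2] := @mixed_difference f x v u t t0.
  move=> r s rt st /=; rewrite addrAC.
  by have [/df[]] := bd _ (inb s r st rt).
have [_ [_ b2]] := bd _ (inb _ _ s2 s1).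
rewrite addrAC in b2.
have close (a b c' : R) : `|a - c'| < e / 2 -> `|b - c'| < e / 2 ->
    `|a - b| <= e.
  move=> h1 h2; apply: le_trans (ler_distD c' a b) _.
  by rewrite (splitr e) lerD ?ltW// distrC.
have aux (a1 a2 a3 a4 : R) : a1 - a2 - (a3 - a4) = a1 - a3 - (a2 - a4) by ring.
have E : 'D_v ('D_u f) (x + rs.1 *: u + rs.2 *: v) =
         'D_u ('D_v f) (x + sr.1 *: v + sr.2 *: u).
  apply: (mulIf (lt0r_neq0 t0)); apply: (mulIf (lt0r_neq0 t0)).
  refine (etrans (esym E1) (etrans _ E2)).
  rewrite [x + t *: v + _]addrAC; exact: aux.
rewrite -E in b2.
exact: (close _ _ _ b1 b2).
Qed.

End Schwarz.

(** * Calculus of matrix-valued functions *)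

Section MatrixCalculus.
Context {R : realType} {V : normedModType R}.

Lemma is_derive_mxP m n (F : V -> 'M[R]_(m, n)) x v (dF : 'M[R]_(m, n)) :
  (forall i j, is_derive x v (fun y => F y i j) (dF i j)) ->
  is_derive x v F dF.
Proof.
move=> FdF; have Fd : derivable F x v by apply/derivable_mxP => i j.
split => //; rewrite derive_mx //; apply/matrixP => i j; rewrite mxE.
exact: derive_val.
Qed.

Lemma is_derive_mxE m n (F : V -> 'M[R]_(m, n)) x v (dF : 'M[R]_(m, n)) i j :
  is_derive x v F dF -> is_derive x v (fun y => F y i j) (dF i j).
Proof.
case=> Fd <-; split; first exact: (derivable_mxP F x v).1.
by rewrite derive_mx // mxE.
Qed.

Lemma is_derive_mulmx m n p (F : V -> 'M[R]_(m, n)) (G : V -> 'M[R]_(n, p))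
    x v (dF : 'M[R]_(m, n)) (dG : 'M[R]_(n, p)) :
  is_derive x v F dF -> is_derive x v G dG ->
  is_derive x v (fun y => F y *m G y) (dF *m G x + F x *m dG).
Proof.
move=> FdF GdG; apply: is_derive_mxP => i j.
have -> : (fun y => (F y *m G y) i j) =
    (\sum_k ((fun y => F y i k) * (fun y => G y k j))).
  by apply/funext => y; rewrite fct_sumE mxE.
have -> : (dF *m G x + F x *m dG) i j =
    \sum_k (F x i k *: dG k j + G x k j *: dF i k).
  rewrite !mxE -big_split /=; apply: eq_bigr => k _.
  by rewrite addrC [_ *: dF _ _]mulrC.
apply: is_derive_sum => k.
by apply: is_deriveM; apply: is_derive_mxE.
Qed.

Lemma is_derive_trmx m n (F : V -> 'M[R]_(m, n)) x v (dF : 'M[R]_(m, n)) :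
  is_derive x v F dF -> is_derive x v (fun y => (F y)^T) dF^T.
Proof.
move=> FdF; apply: is_derive_mxP => i j.
have -> : (fun y => (F y)^T i j) = (fun y => F y j i).
  by apply/funext => y; rewrite mxE.
by rewrite mxE; exact: is_derive_mxE.
Qed.

Lemma is_derive_mxtrace n (F : V -> 'M[R]_n) x v (dF : 'M[R]_n) :
  is_derive x v F dF -> is_derive x v (fun y => \tr (F y)) (\tr dF).
Proof.
move=> FdF.
have -> : (fun y => \tr (F y)) = \sum_i (fun y => F y i i).
  by apply/funext => y; rewrite fct_sumE.
by apply: is_derive_sum => k; apply: is_derive_mxE.
Qed.

Lemma derivable_bigprod (I : Type) (r : seq I) (f : I -> V -> R) x v :
  (forall i, derivable (f i) x v) ->
  derivable (fun y => \prod_(i <- r) f i y) x v.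
Proof.
move=> df; elim: r => [|i r IH].
  rewrite (_ : (fun _ => _) = cst 1); first exact: derivable_cst.
  by apply/funext => y; rewrite big_nil.
rewrite (_ : (fun _ => _) = f i * (fun y => \prod_(i <- r) f i y)).
  exact: derivableM.
by apply/funext => y; rewrite big_cons.
Qed.

Lemma derivable_bigsum (I : Type) (r : seq I) (f : I -> V -> R) x v :
  (forall i, derivable (f i) x v) ->
  derivable (fun y => \sum_(i <- r) f i y) x v.
Proof.
move=> df; elim: r => [|i r IH].
  rewrite (_ : (fun _ => _) = cst 0); first exact: derivable_cst.
  by apply/funext => y; rewrite big_nil.
rewrite (_ : (fun _ => _) = f i + (fun y => \sum_(i <- r) f i y)).
  exact: derivableD.
by apply/funext => y; rewrite big_cons.
Qed.

Lemma derivable_det n (F : V -> 'M[R]_n) x v :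
  derivable F x v -> derivable (fun y => \det (F y)) x v.
Proof.
move=> /derivable_mxP dF; apply: derivable_bigsum => s.
apply: derivableM; first exact: derivable_cst.
exact: derivable_bigprod.
Qed.

Lemma derivable_adj n (F : V -> 'M[R]_n) x v :
  derivable F x v -> derivable (fun y => \adj (F y)) x v.
Proof.
move=> dF; apply/derivable_mxP => i j.
rewrite (_ : (fun _ => _) =
  cst ((-1) ^+ (j + i)) * (fun y => \det (row' j (col' i (F y))))).
  apply: derivableM; first exact: derivable_cst.
  apply: derivable_det; apply/derivable_mxP => k l.
  rewrite (_ : (fun _ => _) = (fun y => F y (lift j k) (lift i l))).
    exact: (derivable_mxP F x v).1.
  by apply/funext => y; rewrite !mxE.
by apply/funext => y; rewrite !mxE.
Qed.

(** [invmx] is the cofactor formula on units only and the identity elsewhere, so invertibility is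
    required near [x]. *)
Lemma derivable_invmx n (F : V -> 'M[R]_n) x v :
  (\forall y \near x, F y \in unitmx) -> derivable F x v ->
  derivable (fun y => invmx (F y)) x v.
Proof.
move=> Fu dF.
apply: (@near_eq_derivable _ _ _ (fun y => (\det (F y))^-1 *: \adj (F y))).
  by apply: filterS Fu => y Fy; rewrite /invmx Fy.
apply/derivable_mxP => i j.
rewrite (_ : (fun _ => _) =
  (fun y => (\det (F y))^-1) * (fun y => \adj (F y) i j)).
  apply: derivableM; last by have /derivable_mxP := derivable_adj dF.
  apply: derivableV; last exact: derivable_det.
  by have := nbhs_singleton Fu; rewrite unitmxE unitfE.
by apply/funext => y; rewrite mxE.
Qed.

End MatrixCalculus.

(** * Derivatives and smoothness on an open set *)

Section OpenSet.
Context {R : realType} {V W : normedModType R} (U : set V) (oU : open U).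

Lemma eq_on_near (f g : V -> W) x : U x -> (forall y, U y -> f y = g y) ->
  \forall y \near x, f y = g y.
Proof.
move=> Ux fg; have : nbhs x U by exact: open_nbhs_nbhs.
exact: filterS.
Qed.

Lemma derive_eq_on (f g : V -> W) x v : U x -> (forall y, U y -> f y = g y) ->
  'D_v f x = 'D_v g x.
Proof. by move=> Ux fg; apply/near_eq_derive/eq_on_near. Qed.

Lemma is_derive_eq_on (f g : V -> W) x v df : U x ->
  (forall y, U y -> f y = g y) -> is_derive x v f df -> is_derive x v g df.
Proof. by move=> Ux fg; apply/near_eq_is_derive/eq_on_near. Qed.

Lemma derivable_eq_on (f g : V -> W) x v : U x ->
  (forall y, U y -> f y = g y) -> derivable f x v -> derivable g x v.
Proof. by move=> Ux fg; apply/near_eq_derivable/eq_on_near. Qed.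

Lemma derive_const_on (f : V -> W) c x v : U x -> (forall y, U y -> f y = c) ->
  'D_v f x = 0.
Proof. by move=> Ux fc; rewrite (@derive_eq_on _ (cst c)) // derive_cst. Qed.

Lemma smooth_differentiable (f : V -> W) x :
  smooth_on U f -> U x -> differentiable f x.
Proof. by move=> /(_ 1%N) /= [df _]; exact: df. Qed.

Lemma smooth_is_derive (f : V -> W) x v :
  smooth_on U f -> U x -> is_derive x v f ('D_v f x).
Proof.
by move=> sf Ux; apply/derivableP/diff_derivable; exact: smooth_differentiable.
Qed.

Lemma smooth_derive (f : V -> W) v : smooth_on U f -> smooth_on U ('D_v f).
Proof. by move=> sf m; have /= [_] := sf m.+1; exact. Qed.

End OpenSet.

(** Reduces to the scalar case entry by entry; taking an entry commutes with differentiation only on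
    [U], where [F] is known to be differentiable. *)
Lemma smooth_derive_comm (R : realType) (V : normedModType R) (U : set V) m n
    (F : V -> 'M[R]_(m, n)) x u v :
  open U -> smooth_on U F -> U x -> 'D_v ('D_u F) x = 'D_u ('D_v F) x.
Proof.
move=> oU sF Ux.
have E w y i j : U y -> 'D_w F y i j = 'D_w (fun y => F y i j) y.
  by move=> Uy; have [d <-] := is_derive_mxE i j (smooth_is_derive w sF Uy).
have E2 w w' y i j : U y ->
    is_derive y w' ('D_w (fun y => F y i j)) ('D_w' ('D_w F) y i j).
  move=> Uy; apply: (is_derive_eq_on oU (f := (fun y => 'D_w F y i j))) => //.
    by move=> ? ?; exact: E.
  apply: is_derive_mxE; apply: (@smooth_is_derive _ _ _ U) => //.
  exact: smooth_derive.
have C w w' i j : {for x, continuous ('D_w' ('D_w (fun y => F y i j)))}.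
  have c : {for x, continuous (fun y => 'D_w' ('D_w F) y i j)}.
    apply: (@continuous_comp _ _ _ ('D_w' ('D_w F)) (fun M => M i j)).
      apply: differentiable_continuous.
      apply: (@smooth_differentiable _ _ _ U) => //.
      by do 2 apply: smooth_derive.
    exact: coord_continuous.
  rewrite /continuous_at /prop_for /=.
  rewrite (derive_val (is_derive := E2 _ _ _ i j Ux)).
  apply: cvg_trans c; apply: near_eq_cvg; apply: (eq_on_near oU) => // y Uy.
  by rewrite (derive_val (is_derive := E2 _ _ _ i j Uy)).
apply/matrixP => i j.
have D1 := @derive_val _ _ _ _ _ _ _ (E2 u v x i j Ux).
have D2 := @derive_val _ _ _ _ _ _ _ (E2 v u x i j Ux).
refine (etrans (esym D1) (etrans _ D2)).
refine (derive_comm oU Ux _ (C _ _ _ _) (C _ _ _ _)) => y Uy; split.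
- exact: (@ex_derive _ _ _ _ _ _ _
    (is_derive_mxE i j (smooth_is_derive u sF Uy))).
- exact: (@ex_derive _ _ _ _ _ _ _
    (is_derive_mxE i j (smooth_is_derive v sF Uy))).
- exact: (@ex_derive _ _ _ _ _ _ _ (E2 u v y i j Uy)).
- exact: (@ex_derive _ _ _ _ _ _ _ (E2 v u y i j Uy)).
Qed.

(** The first-order expansion of [f] at [x] is also one of [g], and [diff_unique] identifies its
    linear part with the differential of [g]. *)
Lemma near_eq_differentiable (R : numFieldType) (V W : normedModType R)
    (f g : V -> W) (x : V) :
  {near x, f =1 g} -> differentiable f x -> differentiable g x.
Proof.
move=> fg /diff_locallyP[dfc /eqaddoP dfo].
have gE : g \o shift x = cst (g x) + 'd f x +o_ 0 id.
  apply/eqaddoP => e e0; have := dfo e e0.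
  have : \forall h \near (0 : V), f (h + x) = g (h + x).
    have : \forall y \near x, f y = g y by exact: fg.
    by rewrite (near_shift 0 x) /= subr0.
  apply: filterS2 => h fgh /=.
  by rewrite /= !fctE /= fgh (nbhs_singleton fg).
by apply/diff_locallyP; rewrite (diff_unique dfc gE).
Qed.

Section SmoothClosure.
Context {R : realType} {V : normedModType R} (U : set V) (oU : open U).

Lemma times_differentiable_eq_on (W : normedModType R) m (f g : V -> W) :
  (forall y, U y -> f y = g y) ->
  times_differentiable m U f -> times_differentiable m U g.
Proof.
elim: m f g => [//|m IH] f g fg /= [df Df]; split=> [x Ux|v].
  by apply: near_eq_differentiable (df x Ux); exact: (eq_on_near oU).
by apply: IH (Df v) => y Uy; exact: (derive_eq_on oU).
Qed.

Lemma smooth_onD (W : normedModType R) (f g : V -> W) :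
  smooth_on U f -> smooth_on U g -> smooth_on U (fun y => f y + g y).
Proof.
move=> sf sg m; elim: m f g sf sg => [//|m IH] f g sf sg /=; split=> [x Ux|v].
  by apply: differentiableD; [exact: smooth_differentiable sf Ux |
                              exact: smooth_differentiable sg Ux].
apply: times_differentiable_eq_on
  (IH _ _ (smooth_derive v sf) (smooth_derive v sg)) => y Uy.
have [_ E] := is_deriveD (smooth_is_derive v sf Uy) (smooth_is_derive v sg Uy).
exact: esym E.
Qed.

Lemma trmx_continuous m n : continuous (@trmx R m n).
Proof.
move=> M P [Q QM QP]; exists (fun i j => Q j i) => [i j|N QN].
  by have := QM j i; rewrite mxE.
by apply: QP => i j; rewrite mxE; exact: QN.
Qed.

Lemma smooth_trmx m n (F : V -> 'M[R]_(m, n)) :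
  smooth_on U F -> smooth_on U (fun y => (F y)^T).
Proof.
move=> sF k; elim: k F sF => [//|k IH] F sF /=; split=> [x Ux|v].
  apply: differentiable_comp; first exact: smooth_differentiable sF Ux.
  by apply: linear_differentiable; exact: trmx_continuous.
apply: times_differentiable_eq_on (IH _ (smooth_derive v sF)) => y Uy.
have [_ E] := is_derive_trmx (smooth_is_derive v sF Uy).
exact: esym E.
Qed.

End SmoothClosure.

(** * Orthonormal frames *)

Section Frames.
Context {R : realType} {n : nat}.
Implicit Types (g T S : 'M[R]_n) (u v w : 'rV[R]_n).

Lemma trmx11 (A : 'M[R]_1) : A^T = A.
Proof. by apply/matrixP => i j; rewrite !ord1 mxE. Qed.

Lemma pair2C g u v : g^T = g -> pair2 g u v = pair2 g v u.
Proof.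
move=> gT; rewrite /pair2 -(trmx11 (u *m g *m v^T)).
by rewrite !trmx_mul gT trmxK mulmxA.
Qed.

Lemma pair2Zl g a u v : pair2 g (a *: u) v = a * pair2 g u v.
Proof. by rewrite /pair2 -!scalemxAl mxE. Qed.

Lemma pair2Zr g a u v : pair2 g u (a *: v) = a * pair2 g u v.
Proof. by rewrite /pair2 linearZ -scalemxAr mxE. Qed.

Definition orthonormal m g (e : 'I_m -> 'rV[R]_n) :=
  forall i j, pair2 g (e i) (e j) = (i == j)%:R.

Lemma frame_mxE m T (e : 'I_m -> 'rV[R]_n) i j :
  (\matrix_i e i *m T *m (\matrix_i e i)^T) i j = pair2 T (e i) (e j).
Proof.
rewrite /pair2 !mxE; apply: eq_bigr => k _; rewrite !mxE; congr (_ * _).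
by apply: eq_bigr => l _; rewrite !mxE.
Qed.

(** Orthonormality gives the frame matrix a right inverse; being square, the matrix has it as a left
    inverse too. This is the completeness relation of the frame. *)
Lemma orthonormal_frameP g (e : 'I_n -> 'rV[R]_n) :
  orthonormal g e -> g *m (\matrix_i e i)^T *m (\matrix_i e i) = 1%:M.
Proof.
move=> eo; apply: mulmx1C; rewrite mulmxA; apply/matrixP => i j.
by rewrite frame_mxE eo mxE.
Qed.

Lemma mxtrace_frame g T (e : 'I_n -> 'rV[R]_n) :
  orthonormal g e -> \tr T = \sum_i pair2 (T *m g) (e i) (e i).
Proof.
move=> /orthonormal_frameP eo; rewrite -[T in LHS]mulmx1 -eo !mulmxA.
rewrite mxtrace_mulC !mulmxA -(mulmxA (\matrix_i e i) T g).
by apply: eq_bigr => i _; rewrite frame_mxE.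
Qed.

Lemma orthonormal_cons m g u (e : 'I_m -> 'rV[R]_n) : g^T = g ->
  orthonormal g e -> pair2 g u u = 1 -> (forall i, pair2 g u (e i) = 0) ->
  orthonormal g (fun i => oapp e u (unlift ord0 i)).
Proof.
move=> gT eo uu ue i j.
case: unliftP => [i' ->|->]; case: unliftP => [j' ->|->] /=.
- by rewrite eo (inj_eq lift_inj).
- by rewrite pair2C // ue lift_eqF.
- by rewrite ue.
- by rewrite uu.
Qed.

(** For a g-symmetric [S] the trace of its square is the sum of the squared lengths of the vectors
    [e i *m S]. *)
Lemma sym_sqr_mxtrace0 g S (e : 'I_n -> 'rV[R]_n) : orthonormal g e ->
  (forall u, u != 0 -> 0 < pair2 g u u) -> (S *m g)^T = S *m g -> g^T = g ->
  \tr (S *m S) = 0 -> S = 0.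
Proof.
move=> eo gpos Sg gT trS.
have E u : pair2 (S *m S *m g) u u = pair2 g (u *m S) (u *m S).
  rewrite /pair2 trmx_mul !mulmxA; congr ((_ *m _) 0 0).
  by rewrite -[LHS]mulmxA -[in LHS]mulmxA -Sg trmx_mul gT !mulmxA.
have ge0 u : 0 <= pair2 g u u.
  have [->|/gpos/ltW//] := eqVneq u 0.
  by rewrite /pair2 !mul0mx mxE.
have eS i : e i *m S = 0.
  move: trS; rewrite (mxtrace_frame _ eo) => /eqP.
  rewrite psumr_eq0; last by move=> j _; rewrite E.
  move=> /allP/(_ i (mem_index_enum _)); rewrite E.
  by apply: contraTeq => /gpos; rewrite lt_neqAle eq_sym => /andP[].
have E0 : \matrix_i e i *m S = 0.
  by apply/row_matrixP => i; rewrite row_mul rowK eS row0.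
by rewrite -[S]mul1mx -(orthonormal_frameP eo) -mulmxA E0 mulmx0.
Qed.

Lemma posdef_unitmx g : (forall u, u != 0 -> 0 < pair2 g u u) -> g \in unitmx.
Proof.
move=> gpos; rewrite -row_free_unit -kermx_eq0; apply/rowV0P => u.
move=> /sub_kermxP ug; apply/eqP; apply: contraT => /gpos.
by rewrite /pair2 ug mul0mx mxE ltxx.
Qed.

Lemma normalized g u : 0 < pair2 g u u ->
  pair2 g ((Num.sqrt (pair2 g u u))^-1 *: u)
          ((Num.sqrt (pair2 g u u))^-1 *: u) = 1.
Proof.
move=> u0; rewrite pair2Zl pair2Zr mulrA -expr2 exprVn sqr_sqrtr ?ltW //.
by rewrite mulVf // gt_eqF.
Qed.

(** Dimension count: [g *m B^T] has fewer columns than rows, hence a nonzero left kernel. *)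
Lemma orthogonal_vector m g (B : 'M[R]_(m, n)) : (m < n)%N ->
  exists2 w : 'rV[R]_n, w != 0 & forall i, pair2 g w (row i B) = 0.
Proof.
move=> mn; have /rowV0Pn[w /sub_kermxP wB w0] : kermx (g *m B^T) != 0.
  rewrite -mxrank_eq0 mxrank_ker subn_eq0 -ltnNge.
  by rewrite (leq_ltn_trans (rank_leq_col _)).
exists w => // i; have /matrixP/(_ 0 i) := wB.
rewrite mulmxA [RHS]mxE => <-; rewrite /pair2 [LHS]mxE [RHS]mxE.
by apply: eq_bigr => k _; rewrite !mxE.
Qed.

(** Gram-Schmidt without a starting basis: each step normalizes some vector orthogonal to [u] and to
    the vectors already found. The strict bound on [m] leaves room for [u] among the constraints. *)
Lemma orthonormal_exists g u : g^T = g ->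
  (forall u, u != 0 -> 0 < pair2 g u u) -> forall m, (m < n)%N ->
  exists e : 'I_m -> 'rV[R]_n, orthonormal g e /\ forall i, pair2 g u (e i) = 0.
Proof.
move=> gT gpos; elim=> [|m IH] mn; first by exists (fun=> 0); split=> -[].
have [e [eo ue]] := IH (ltnW mn).
have [w w0 wB] :=
  orthogonal_vector g (\matrix_i oapp e u (unlift ord0 i) : 'M[R]_(m.+1, n)) mn.
pose w' := (Num.sqrt (pair2 g w w))^-1 *: w.
have we i : pair2 g w' (e i) = 0.
  have := wB (lift ord0 i); rewrite rowK liftK pair2Zl /= => ->.
  by rewrite mulr0.
have wu : pair2 g u w' = 0.
  rewrite pair2C // pair2Zl; have := wB ord0; rewrite rowK unlift_none /= => ->.
  by rewrite mulr0.
exists (fun i => oapp e w' (unlift ord0 i)); split.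
  by apply: orthonormal_cons => //; apply: normalized; exact: gpos.
by move=> i; case: unliftP => [j _|_] /=.
Qed.

End Frames.

Lemma mxtrace_complement (R : realType) n (g T : 'M[R]_n) (u : 'rV[R]_n)
    (e : 'I_n.-1 -> 'rV[R]_n) : g^T = g -> orthonormal g e ->
  0 < pair2 g u u -> (forall i, pair2 g u (e i) = 0) ->
  \tr T = \sum_i pair2 (T *m g) (e i) (e i) +
          pair2 (T *m g) u u / pair2 g u u.
Proof.
case: n g T u e => [|n] g T u e gT eo u0 ue.
  by move: u0; rewrite [u]thinmx0 /pair2 !mul0mx mxE ltxx.
set s := (Num.sqrt (pair2 g u u))^-1.
have eo' := orthonormal_cons gT eo (normalized u0)
  (fun i => etrans (pair2Zl _ _ _ _) (etrans (congr1 _ (ue i)) (mulr0 _))).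
rewrite (mxtrace_frame _ eo') big_ord_recl addrC /=; congr (_ + _).
  by apply: eq_bigr => i _; rewrite liftK.
rewrite unlift_none /= pair2Zl pair2Zr mulrA mulrC -expr2 exprVn sqr_sqrtr //.
exact: ltW.
Qed.

Lemma orthonormal_basis_exists (R : realType) n (g : 'M[R]_n) : g^T = g ->
  (forall u, u != 0 -> 0 < pair2 g u u) ->
  exists e : 'I_n -> 'rV[R]_n, orthonormal g e.
Proof.
case: n g => [|n] g gT gpos; first by exists (fun=> 0) => -[].
have u0 : delta_mx 0 0 != 0 :> 'rV[R]_n.+1.
  by apply/eqP => /matrixP/(_ 0 0)/eqP; rewrite !mxE /= oner_eq0.
have [e [eo ue]] := orthonormal_exists (delta_mx 0 0) gT gpos (ltnSn n).
have ue' i := etrans (pair2Zl g (Num.sqrt (pair2 g (delta_mx 0 0)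
  (delta_mx 0 0)))^-1 (delta_mx 0 0) (e i))
  (etrans (congr1 _ (ue i)) (mulr0 _)).
by eexists; exact: (orthonormal_cons gT eo (normalized (gpos _ u0)) ue').
Qed.

(** * Christoffel symbols and curvature in coordinates *)

Section MatrixAlgebra.
Context {R : realType}.

Lemma trmxD m n (A B : 'M[R]_(m, n)) : (A + B)^T = A^T + B^T.
Proof. by apply/matrixP => i j; rewrite !mxE. Qed.

Lemma trmxN m n (A : 'M[R]_(m, n)) : (- A)^T = - A^T.
Proof. by apply/matrixP => i j; rewrite !mxE. Qed.

Lemma trmxZ m n a (A : 'M[R]_(m, n)) : (a *: A)^T = a *: A^T.
Proof. by apply/matrixP => i j; rewrite !mxE. Qed.

End MatrixAlgebra.

Ltac mx_norm :=
  rewrite ?(trmxD, trmxN, trmxZ, trmxK, trmx_mul, trmx0, trmx1);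
  rewrite -?(scalemxAl, scalemxAr);
  rewrite ?(mulmxDl, mulmxDr, mulmxN, mulNmx, mulmx0, mul0mx, mulmx1, mul1mx,
    mulmxA);
  rewrite -?(scalemxAl, scalemxAr);
  rewrite ?(mulmxDl, mulmxDr, mulmxN, mulNmx, mulmx0, mul0mx, mulmx1, mul1mx,
    mulmxA).

(** Proves identities between noncommutative polynomials in matrices: after expansion the products
    become opaque letters, and the linear identity left over is checked entrywise. The call to
    [field] deals with the factors 2^-1. *)
Ltac mx_ring :=
  mx_norm;
  repeat (match goal with |- context [mulmx ?A ?B] =>
            let X := fresh "X" in set X := (mulmx A B); clearbody X end);
  apply/matrixP => ? ?; rewrite ?mxE; (ring || by field).

(** The last hypothesis is the equality of the mixed second derivatives of g, each expanded by
    differentiating metric compatibility once more. The mixed terms cancel and leave C g + (C g)^T =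
    0. *)
Lemma skew_curvature_alg (R : realType) n (g Gu Gv DuGv DvGu Du Dv : 'M[R]_n) :
  g^T = g -> Gu *m g + g *m Gu^T = Du -> Gv *m g + g *m Gv^T = Dv ->
  DvGu *m g + Gu *m Dv + (Dv *m Gu^T + g *m DvGu^T) =
  DuGv *m g + Gv *m Du + (Du *m Gv^T + g *m DuGv^T) ->
  let C := DuGv - DvGu + Gv *m Gu - Gu *m Gv in (C *m g)^T = - (C *m g).
Proof.
move=> gT <- <- /eqP; rewrite -subr_eq0 => /eqP H C.
apply/eqP; rewrite -subr_eq0 opprK -oppr_eq0 -[X in _ == X]H; apply/eqP.
rewrite trmx_mul gT /C; mx_ring.
Qed.

Section LocalRiemann.
Context {R : realType} {n : nat} {U : set 'rV[R]_n} (oU : open U).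
Local Notation E := 'rV[R]_n.

Lemma derive_sum_dir p q (F : E -> 'M[R]_(p, q)) x v : smooth_on U F -> U x ->
  'D_v F x = \sum_i v 0 i *: 'D_(delta_mx 0 i) F x.
Proof.
move=> sF Ux; rewrite {1}(row_sum_delta v).
have dF := smooth_differentiable sF Ux.
rewrite deriveE // linear_sum; apply: eq_bigr => i _.
by rewrite deriveE // linearZ.
Qed.

(** The bilinear form (v, w) -> (D_v F)(u, w): the direction of differentiation becomes the row
    argument, so that all three Koszul terms are matrices. *)
Definition grad (F : E -> 'M[R]_n) (u y : E) : 'M[R]_n :=
  \matrix_i (u *m 'D_(delta_mx 0 i) F y).

Lemma mul_grad F u v y : smooth_on U F -> U y ->
  v *m grad F u y = u *m 'D_v F y.
Proof.
move=> sF Uy; rewrite (derive_sum_dir v sF Uy) mulmx_sum_row mulmx_sumr.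
by apply: eq_bigr => i _; rewrite rowK -scalemxAr.
Qed.

Lemma derivable_grad F u y v : smooth_on U F -> U y -> derivable (grad F u) y v.
Proof.
move=> sF Uy; apply/derivable_mxP => i j.
have := smooth_is_derive v (smooth_derive (delta_mx 0 i) sF) Uy.
move=> /(is_derive_mulmx (is_derive_cst u y v))/(is_derive_mxE 0 j) d.
rewrite (_ : (fun _ => _) =
  fun y => (cst u y *m 'D_(delta_mx 0 i) F y) 0 j); first exact: ex_derive.
by apply/funext => z; rewrite mxE.
Qed.

Lemma derivable_jacobian (z : E -> E) y v :
  smooth_on U z -> U y -> derivable (jacobian z) y v.
Proof.
move=> sz Uy; apply/derivable_mxP => i j.
apply: (derivable_eq_on (f := fun y => 'D_(delta_mx 0 i) z y 0 j) oU Uy).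
  move=> x Ux; rewrite deriveEjacobian; last exact: smooth_differentiable sz Ux.
  by rewrite -rowE mxE.
have := is_derive_mxE 0 j
  (smooth_is_derive v (smooth_derive (delta_mx 0 i) sz) Uy).
by case.
Qed.

Lemma mul_jacobian (z : E -> E) y v : smooth_on U z -> U y ->
  v *m jacobian z y = 'D_v z y.
Proof.
by move=> sz Uy; rewrite deriveEjacobian //; exact: smooth_differentiable sz Uy.
Qed.

Lemma mul_derive_jacobian (z : E -> E) y u v : smooth_on U z -> U y ->
  u *m 'D_v (jacobian z) y = 'D_v ('D_u z) y.
Proof.
move=> sz Uy.
have d := is_derive_mulmx (is_derive_cst u y v)
  (derivableP (@derivable_jacobian z y v sz Uy)).
rewrite -[LHS]add0r -[X in X + _](mul0mx _ (jacobian z y)).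
rewrite -(derive_val (is_derive := d)); apply: (derive_eq_on oU) => // x Ux.
exact: mul_jacobian.
Qed.

Variables (g : E -> 'M[R]_n) (sg : smooth_on U g).
Hypothesis gT : forall y, U y -> (g y)^T = g y.
Hypothesis gU : forall y, U y -> g y \in unitmx.

(** Christoffel symbols of the first kind: evaluated on v and w this is g(nabla_u v, w) for constant
    fields, and the transposed gradient is the Koszul term differentiated along w. *)
Definition lowered_christoffel (u y : E) : 'M[R]_n :=
  2^-1 *: ('D_u g y + grad g u y - (grad g u y)^T).

Definition christoffel_mx (u y : E) : 'M[R]_n :=
  lowered_christoffel u y *m invmx (g y).
Local Notation Gam := christoffel_mx.
Local Notation low := lowered_christoffel.

Lemma derive_sym u y : U y -> ('D_u g y)^T = 'D_u g y.
Proof.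
move=> Uy; have d := is_derive_trmx (smooth_is_derive u sg Uy).
by rewrite -(derive_val (is_derive := d)); apply: (derive_eq_on oU).
Qed.

(** The j-th entry of either side is the j-th partial derivative of g(u, v), and g is symmetric. *)
Lemma grad_trC u v y : U y -> v *m (grad g u y)^T = u *m (grad g v y)^T.
Proof.
move=> Uy; apply/rowP => j; rewrite !mxE.
have E (w w' : 'rV[R]_n) i : \sum_k w 0 k * (grad g w' y)^T k i =
    pair2 ('D_(delta_mx 0 i) g y) w w'.
  rewrite /pair2 -mulmxA -[in RHS](derive_sym _ Uy) -trmx_mul [RHS]mxE.
  by apply: eq_bigr => k _; rewrite !mxE.
by rewrite !E pair2C // derive_sym.
Qed.

(** Torsion-freeness: exchanging [u] and [v] swaps the first two Koszul terms and fixes the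
    third. *)
Lemma lowered_christoffelC u v y : U y -> v *m low u y = u *m low v y.
Proof.
move=> Uy; rewrite /lowered_christoffel -!scalemxAr !mulmxBr !mulmxDr.
rewrite !mul_grad //.
by rewrite (grad_trC u v Uy) (addrC (v *m 'D_u g y)).
Qed.

Lemma christoffel_mxC u v y : U y -> v *m Gam u y = u *m Gam v y.
Proof. by move=> Uy; rewrite /christoffel_mx !mulmxA lowered_christoffelC. Qed.

Lemma lowered_christoffel_mul u y : U y -> Gam u y *m g y = low u y.
Proof. by move=> Uy; rewrite /christoffel_mx mulmxKV // gU. Qed.

(** This is nabla g = 0: the gradient terms of the lowered symbols cancel against their
    transposes. *)
Lemma christoffel_compat u y : U y ->
  Gam u y *m g y + g y *m (Gam u y)^T = 'D_u g y.
Proof.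
move=> Uy; rewrite -{2}(gT Uy) -trmx_mul lowered_christoffel_mul //.
rewrite /lowered_christoffel; have := derive_sym u Uy.
move: ('D_u g y) (grad g u y) => D Q DT; apply/matrixP => i j.
by move/matrixP/(_ i j): DT; rewrite !mxE => ->; field.
Qed.

Lemma derivable_christoffel u y v : U y -> derivable (Gam u) y v.
Proof.
move=> Uy.
have dg := smooth_is_derive v sg Uy.
have di : derivable (fun y => invmx (g y)) y v.
  apply: derivable_invmx; last by case: dg.
  have : nbhs y U by apply: open_nbhs_nbhs.
  exact: filterS.
have dq := derivableP (@derivable_grad g u y v sg Uy).
have dlow : derivable (low u) y v.
  apply: derivableZ; apply: derivableB.
    apply: derivableD; last by case: dq.
    by case: (smooth_is_derive v (smooth_derive u sg) Uy).
  by case: (is_derive_trmx dq).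
by case: (is_derive_mulmx (derivableP dlow) (derivableP di)).
Qed.

(* w *m curvature_mx u v y is R(u,v)w; the products appear reversed because
   matrices act on row vectors from the right. *)
Definition curvature_mx (u v y : E) : 'M[R]_n :=
  'D_u (Gam v) y - 'D_v (Gam u) y + Gam v y *m Gam u y - Gam u y *m Gam v y.

Lemma derive_christoffel_compat u v x : U x ->
  'D_v ('D_u g) x = 'D_v (Gam u) x *m g x + Gam u x *m 'D_v g x +
    ('D_v g x *m (Gam u x)^T + g x *m ('D_v (Gam u) x)^T).
Proof.
move=> Ux; have dG := derivableP (@derivable_christoffel u x v Ux).
have dg := smooth_is_derive v sg Ux.
have d := is_deriveD (is_derive_mulmx dG dg)
  (is_derive_mulmx dg (is_derive_trmx dG)).
rewrite -(derive_val (is_derive := d)); apply: (derive_eq_on oU) => // y Uy.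
by rewrite -christoffel_compat.
Qed.

Lemma curvature_skew u v x : U x ->
  (curvature_mx u v x *m g x)^T = - (curvature_mx u v x *m g x).
Proof.
move=> Ux; apply: skew_curvature_alg (gT Ux) (christoffel_compat u Ux)
  (christoffel_compat v Ux) _.
exact: (etrans (esym (derive_christoffel_compat u v Ux))
  (etrans (smooth_derive_comm u v oU sg Ux)
    (derive_christoffel_compat v u Ux))).
Qed.
End LocalRiemann.

(** * The Riccati equation along a geodesic field *)

(** Here [c] is the value of Z, [J] its Jacobian, [e] a test vector and [s] the mixed second
    derivative of Z along both. Since [s] occurs in both derivatives of A, it drops out of the
    curvature; the last hypothesis is A Z = 0 differentiated along [e]. *)
Lemma riccati_alg (R : realType) n (c e s : 'rV[R]_n)
    (A J Gc Ge DcA DeA DcGe DeGc : 'M[R]_n) :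
  A = J + Gc -> c *m Ge = e *m Gc -> c *m A = 0 ->
  e *m DcA = s + (c *m J *m Ge + c *m DcGe) ->
  c *m DeA = s + (e *m J *m Gc + c *m DeGc) ->
  e *m J *m A + c *m DeA = 0 ->
  c *m (DcGe - DeGc + Ge *m Gc - Gc *m Ge) =
  e *m (DcA + A *m A - Gc *m A + A *m Gc).
Proof.
move=> AE cGe cA eDcA cDeA eJA.
have JE : J = A - Gc by rewrite AE addrK.
have h1 : c *m DcGe = e *m DcA - s - c *m J *m Ge.
  rewrite eDcA; mx_ring.
have h2 : c *m DeGc = - (e *m J *m A) - s - e *m J *m Gc.
  rewrite -[RHS]add0r -eJA cDeA; mx_ring.
mx_norm; rewrite h1 h2 cGe JE; mx_norm; rewrite cA; mx_ring.
Qed.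

Section Riccati.
Context {R : realType} {n : nat} {U : set 'rV[R]_n} (oU : open U).
Local Notation E := 'rV[R]_n.
Variables (g : E -> 'M[R]_n) (sg : smooth_on U g).
Hypothesis gT : forall y, U y -> (g y)^T = g y.
Hypothesis gpos : forall y, U y -> forall u, u != 0 -> 0 < pair2 (g y) u u.
Variables (z : E -> E) (sz : smooth_on U z).
Local Notation Gam := (christoffel_mx g).

Let gU y : U y -> g y \in unitmx.
Proof. by move=> Uy; apply: posdef_unitmx; exact: gpos. Qed.

(** The endomorphism v -> nabla_v Z. Torsion-freeness allows Z to be the direction in the
    Christoffel matrix, which makes the dependence on v a matrix product. *)
Definition nabla_mx (y : E) : 'M[R]_n := jacobian z y + Gam (z y) y.
Local Notation A := nabla_mx.

Lemma mul_nabla v y : U y -> v *m A y = 'D_v z y + z y *m Gam v y.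
Proof.
by move=> Uy; rewrite /nabla_mx mulmxDr (mul_jacobian v sz Uy)
  (christoffel_mxC oU sg gT (z y) v Uy).
Qed.

Lemma is_derive_mul_nabla v e x : U x ->
  is_derive x e (fun y => v *m A y)
    ('D_e ('D_v z) x + ('D_e z x *m Gam v x + z x *m 'D_e (Gam v) x)).
Proof.
move=> Ux.
apply: (is_derive_eq_on oU Ux (f := fun y => 'D_v z y + z y *m Gam v y)).
  by move=> y Uy; rewrite mul_nabla.
apply: is_deriveD; first exact: (smooth_is_derive e (smooth_derive v sz) Ux).
apply: is_derive_mulmx; first exact: smooth_is_derive.
by apply: derivableP; exact: (derivable_christoffel oU sg gU Ux).
Qed.

Lemma derivable_nabla x e : U x -> derivable A x e.
Proof.
move=> Ux; apply/derivable_mxP => i j.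
have [d _] := is_derive_mxE 0 j (is_derive_mul_nabla (delta_mx 0 i) e Ux).
by apply: (derivable_eq_on oU Ux _ d) => y _; rewrite -rowE mxE.
Qed.

Lemma mul_derive_nabla v e x : U x ->
  v *m 'D_e A x =
    'D_e ('D_v z) x + ('D_e z x *m Gam v x + z x *m 'D_e (Gam v) x).
Proof.
move=> Ux; have [_ <-] := is_derive_mul_nabla v e Ux.
have [_ ->] := is_derive_mulmx (is_derive_cst v x e)
  (derivableP (@derivable_nabla x e Ux)).
by rewrite mul0mx add0r.
Qed.

Hypothesis zA : forall y, U y -> z y *m A y = 0.

(** The derivative of A and the two terms with Christoffel matrices make up the covariant derivative
    nabla_Z A. *)
Lemma geodesic_riccati e x : U x ->
  z x *m curvature_mx g (z x) e x =
  e *m ('D_(z x) A x + A x *m A x - Gam (z x) x *m A x + A x *m Gam (z x) x).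
Proof.
move=> Ux.
apply: (@riccati_alg _ _ (z x) e ('D_(z x) ('D_e z) x) (A x) (jacobian z x)
  _ _ _ ('D_e A x)) => //.
- exact: (christoffel_mxC oU sg gT e (z x) Ux).
- exact: zA.
- by rewrite mul_derive_nabla // (mul_jacobian (z x) sz Ux).
- rewrite mul_derive_nabla // (mul_jacobian e sz Ux).
  by rewrite (smooth_derive_comm _ _ oU sz Ux).
- rewrite (mul_jacobian e sz Ux).
  have [_ <-] := is_derive_mulmx (smooth_is_derive e sz Ux)
    (derivableP (@derivable_nabla x e Ux)).
exact: (derive_const_on oU _ Ux zA).
Qed.

Hypothesis trA : forall y, U y -> \tr (A y) = 0.

(** Skewness of the curvature turns each summand into minus a diagonal entry of nabla_Z A + A^2. The
    direction of Z completes the trace at no cost, as R(Z, Z) = 0, and the Christoffel terms form a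
    commutator, of trace zero. *)
Lemma geodesic_ricci x (e : 'I_n.-1 -> E) : U x -> z x != 0 ->
  orthonormal (g x) e -> (forall i, pair2 (g x) (z x) (e i) = 0) ->
  \sum_i pair2 (curvature_mx g (z x) (e i) x *m g x) (e i) (z x) =
  - \tr (A x *m A x).
Proof.
move=> Ux z0 eo ze.
set T := 'D_(z x) A x + A x *m A x - Gam (z x) x *m A x + A x *m Gam (z x) x.
have E v : pair2 (curvature_mx g (z x) v x *m g x) v (z x) =
    - pair2 (T *m g x) v v.
  rewrite /pair2 [v *m (T *m _)]mulmxA -(geodesic_riccati v Ux).
  have := curvature_skew oU sg gT gU (z x) v Ux.
  move: (z x) (curvature_mx _ _ _ _) => c C CT.
  rewrite -(trmx11 (v *m (C *m g x) *m c^T)) trmx_mul trmxK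
    trmx_mul CT.
  by rewrite mulmxA mulmxN mulNmx mxE !mulmxA.
rewrite (eq_bigr _ (fun i _ => E (e i))) sumrN; congr (- _).
have := mxtrace_complement T (gT Ux) eo (gpos Ux z0) ze.
have -> : pair2 (T *m g x) (z x) (z x) = 0.
  apply: oppr_inj; rewrite -E oppr0 /pair2 /curvature_mx !subrr add0r subrr.
  by rewrite mul0mx mulmx0 mul0mx mxE.
rewrite mul0r addr0 => <-.
have -> : \tr T = \tr ('D_(z x) A x) + \tr (A x *m A x).
  rewrite /T !mxtraceD [\tr (- _)]raddfN /= (mxtrace_mulC (A x) (Gam _ _)).
  by rewrite -addrA addNr addr0.
have [_ d] := is_derive_mxtrace (derivableP (@derivable_nabla x (z x) Ux)).
by rewrite -d (derive_const_on oU _ Ux trA) add0r.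
Qed.

End Riccati.

(** * Exterior derivatives and Lie derivatives of one-forms *)

Section MatrixTests.
Context {R : realType}.

Lemma mulmx_row_eq0 m n (M : 'M[R]_(m, n)) :
  (forall u : 'rV_m, u *m M = 0) -> M = 0.
Proof. by move=> M0; apply/row_matrixP => i; rewrite row0 rowE M0. Qed.

Lemma mulmx_form_eq0 m n (M : 'M[R]_(m, n)) :
  (forall (u : 'rV_m) (v : 'rV_n), u *m M *m v^T = 0) -> M = 0.
Proof.
move=> M0; apply: mulmx_row_eq0 => u; apply: trmx_inj; rewrite trmx0.
by apply: mulmx_row_eq0 => v; rewrite -(trmx11 (v *m _)) trmx_mul trmxK M0.
Qed.

(** Here [W] is db and [PX], [Pu], [Pv] are derivatives of the Jacobian of b. Differentiating i_X db
    = 0 along [u] and [v] trades the terms in [J] for derivatives of [W]; what is left is the cyclic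
    sum expressing d(db) on X, u, v. *)
Lemma lie_closed_form_alg n (X u v : 'rV[R]_n)
    (J W DXW DuW DvW PX Pu Pv : 'M[R]_n) :
  W^T = - W ->
  DXW = 2^-1 *: (PX - PX^T) -> DuW = 2^-1 *: (Pu - Pu^T) ->
  DvW = 2^-1 *: (Pv - Pv^T) ->
  X *m Pu = u *m PX -> X *m Pv = v *m PX -> v *m Pu = u *m Pv ->
  u *m J *m W + X *m DuW = 0 -> v *m J *m W + X *m DvW = 0 ->
  u *m (DXW + J *m W + W *m J^T) *m v^T = 0.
Proof.
move=> WT EX Eu Ev XPu XPv vPu /eqP; rewrite addr_eq0 => /eqP uJ /eqP.
rewrite addr_eq0 => /eqP vJ.
have tr (a b : 'rV[R]_n) (P : 'M[R]_n) : a *m P^T *m b^T = b *m P *m a^T.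
  by rewrite -(trmx11 (a *m P^T *m b^T)) !trmx_mul !trmxK mulmxA.
have uWJ : u *m W *m J^T *m v^T = X *m DvW *m u^T.
  rewrite -(trmx11 (u *m W *m J^T *m v^T)) !trmx_mul !trmxK WT.
  by rewrite mulNmx !mulmxN mulmxA mulmxA vJ mulNmx opprK.
rewrite !(mulmxDr, mulmxDl) !mulmxA uJ uWJ EX Eu Ev.
have t1 : X *m Pu^T *m v^T = u *m Pv *m X^T by rewrite tr vPu.
have t2 : X *m Pv^T *m u^T = u *m Pv *m X^T by rewrite tr.
mx_norm; rewrite t1 t2 XPu XPv (tr u v PX); mx_ring.
Qed.

End MatrixTests.

Section ExteriorDerivative.
Context {R : realType} {n : nat} {U : set 'rV[R]_n} (oU : open U).
Local Notation E := 'rV[R]_n.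
Implicit Types X Y b : E -> E.

Lemma jacobianD X Y x : smooth_on U X -> smooth_on U Y -> U x ->
  jacobian (fun y => X y + Y y) x = jacobian X x + jacobian Y x.
Proof.
move=> sX sY Ux; apply/eqP; rewrite -subr_eq0; apply/eqP/mulmx_row_eq0 => u.
have alg (A B C : 'M[R]_n) (a b : E) : u *m A = a + b -> u *m B = a ->
    u *m C = b -> u *m (A - (B + C)) = 0.
  by move=> uA uB uC; rewrite mulmxBr mulmxDr uA uB uC subrr.
have [_ D] := is_deriveD (smooth_is_derive u sX Ux) (smooth_is_derive u sY Ux).
have e1 := mul_jacobian u (smooth_onD oU sX sY) Ux.
have e2 := mul_jacobian u sX Ux; have e3 := mul_jacobian u sY Ux.
exact: alg (etrans e1 D) e2 e3.
Qed.

(** One-forms are stored as rows here so that [jacobian] applies to them; the factor 2^-1 is that of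
    [ext_d]. *)
Definition extd_mx b (y : E) : 'M[R]_n :=
  2^-1 *: (jacobian b y - (jacobian b y)^T).

Lemma extd_mxT b y : (extd_mx b y)^T = - extd_mx b y.
Proof. by rewrite /extd_mx; move: (jacobian b y) => K; mx_ring. Qed.

Lemma is_derive_extd b x v : smooth_on U b -> U x ->
  is_derive x v (extd_mx b)
    (2^-1 *: ('D_v (jacobian b) x - ('D_v (jacobian b) x)^T)).
Proof.
move=> sb Ux; have d := derivableP (@derivable_jacobian _ _ _ oU b x v sb Ux).
by apply: is_deriveZ; apply: is_deriveB; apply: is_derive_trmx.
Qed.

(* L_X db = 0, by Cartan's formula: i_X db = 0, and d(db) = 0 amounts to the
   symmetry of the second derivatives of b. *)
Lemma lie_extd X b x : smooth_on U X -> smooth_on U b ->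
  (forall y, U y -> X y *m extd_mx b y = 0) -> U x ->
  'D_(X x) (extd_mx b) x + jacobian X x *m extd_mx b x +
    extd_mx b x *m (jacobian X x)^T = 0.
Proof.
move=> sX sb Xb Ux; apply: mulmx_form_eq0 => u v.
have EP w : 'D_w (extd_mx b) x =
    2^-1 *: ('D_w (jacobian b) x - ('D_w (jacobian b) x)^T).
  by have [_ ->] := is_derive_extd w sb Ux.
have sym w w' : w *m 'D_w' (jacobian b) x = w' *m 'D_w (jacobian b) x.
  rewrite !(mul_derive_jacobian oU _ _ sb Ux).
  by rewrite (smooth_derive_comm _ _ oU sb Ux).
have prod w : w *m jacobian X x *m extd_mx b x + X x *m 'D_w (extd_mx b) x = 0.
  rewrite (mul_jacobian w sX Ux).
  have [dW _] := is_derive_extd w sb Ux.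
  have [_ D] := is_derive_mulmx (smooth_is_derive w sX Ux) (derivableP dW).
  exact: etrans (esym D) (derive_const_on oU _ Ux Xb).
exact: (lie_closed_form_alg (extd_mxT b x) (EP _) (EP u) (EP v)
  (sym _ _) (sym _ _) (sym _ _) (prod u) (prod v)).
Qed.

(** An instance of i_[X,Y] = L_X i_Y - i_Y L_X: both terms on the right vanish on db. *)
Lemma bracket_extd X Y b x : smooth_on U X -> smooth_on U Y -> smooth_on U b ->
  (forall y, U y -> X y *m extd_mx b y = 0) ->
  (forall y, U y -> Y y *m extd_mx b y = 0) -> U x ->
  (X x *m jacobian Y x - Y x *m jacobian X x) *m extd_mx b x = 0.
Proof.
move=> sX sY sb Xb Yb Ux; rewrite (mul_jacobian (X x) sY Ux).
have [dW _] := is_derive_extd (X x) sb Ux.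
have [_ D] := is_derive_mulmx (smooth_is_derive (X x) sY Ux) (derivableP dW).
have {D} := etrans (esym D) (derive_const_on oU _ Ux Yb).
have := lie_extd sX sb Xb Ux; have := Yb x Ux.
move: (X x) (Y x) (jacobian X x) (extd_mx b x) ('D_(X x) (extd_mx b) x)
  ('D_(X x) Y x) => X0 Y0 J W DW DY Y0W L D.
have : Y0 *m (DW + J *m W + W *m J^T) = 0 by rewrite L mulmx0.
rewrite !mulmxDr !mulmxA Y0W mul0mx addr0 => H.
rewrite mulmxBl; move: D H.
move: (Y0 *m DW) (DY *m W) (Y0 *m J *m W) => p q r.
move=> /eqP; rewrite addr_eq0 => /eqP ->.
by rewrite addrC => /eqP; rewrite addr_eq0 => /eqP ->; rewrite subrr.
Qed.

(* L_X b = 0 *)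
Lemma lie_form X b c x : smooth_on U X -> smooth_on U b ->
  (forall y, U y -> X y *m (b y)^T = c) -> U x -> X x *m extd_mx b x = 0 ->
  b x *m (jacobian X x)^T + X x *m jacobian b x = 0.
Proof.
move=> sX sb Xb Ux Xd; apply: trmx_inj; rewrite trmx0.
apply: mulmx_row_eq0 => u.
have [_ D] := is_derive_mulmx (smooth_is_derive u sX Ux)
  (is_derive_trmx (smooth_is_derive u sb Ux)).
have {D} := etrans (esym D) (derive_const_on oU _ Ux Xb).
have e1 := mul_jacobian u sX Ux; have e2 := mul_jacobian u sb Ux.
move: Xd; rewrite /extd_mx; move: e1 e2.
move: (X x) (b x) (jacobian X x) (jacobian b x) ('D_u X x) ('D_u b x).
move=> X0 b0 J K DX Db <- <- {sX sb Xb}.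
rewrite -scalemxAr => /eqP; rewrite scaler_eq0 invr_eq0 pnatr_eq0 /=.
rewrite mulmxBr subr_eq0 => /eqP XK.
rewrite trmxD !trmx_mul !trmxK mulmxDr !mulmxA => H; rewrite -[RHS]H.
congr (_ + _).
by rewrite -[LHS]trmx11 !trmx_mul !trmxK mulmxA XK.
Qed.

End ExteriorDerivative.

(** * Linear algebra of a metric contact pair *)

Section ContactAlgebra.
Context {R : realType} {n : nat}.
Implicit Types (X Y b z : 'rV[R]_n).

(** With [K] the Jacobian of b, the first two hypotheses are L_X b = 0 and L_Y b = 0. Together with
    i_X db = i_Y db = 0 they make both terms of b([X, Y]) equal to - (D_X b)(Y). *)
Lemma bracket_form_alg X Y b (JX JY K : 'M[R]_n) :
  b *m JX^T + X *m K = 0 -> b *m JY^T + Y *m K = 0 ->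
  X *m (2^-1 *: (K - K^T)) = 0 -> Y *m (2^-1 *: (K - K^T)) = 0 ->
  (X *m JY - Y *m JX) *m b^T = 0.
Proof.
move=> fX fY XK YK.
have half (Z : 'rV[R]_n) : Z *m (2^-1 *: (K - K^T)) = 0 -> Z *m K^T = Z *m K.
  rewrite -scalemxAr => /eqP; rewrite scaler_eq0 invr_eq0 pnatr_eq0 /=.
  by rewrite mulmxBr subr_eq0 => /eqP ->.
have E (Z W : 'rV[R]_n) (J : 'M[R]_n) :
    b *m J^T + Z *m K = 0 -> W *m J *m b^T = - (W *m K^T *m Z^T).
  move=> /eqP; rewrite addr_eq0 => /eqP bJ.
  rewrite -[LHS]trmx11 !trmx_mul !trmxK mulmxA bJ mulNmx.
  by rewrite -[LHS]trmx11 trmxN !trmx_mul !trmxK mulmxA.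
rewrite mulmxBl (E _ _ _ fY) (E _ _ _ fX) (half X XK).
rewrite -[X in _ - - X]trmx11 !trmx_mul !trmxK mulmxA opprK addrC.
by rewrite subrr.
Qed.

Lemma mxtrace_outer (b z : 'rV[R]_n) (a : R) :
  z *m b^T = a%:M -> \tr (b^T *m z) = a.
Proof. by move=> zb; rewrite mxtrace_mulC zb mxtrace_scalar. Qed.

Variables (g f L H : 'M[R]_n) (z1 z2 b1 b2 : 'rV[R]_n).
Hypotheses (gT : g^T = g) (gU : g \in unitmx) (LT : L^T = L).
Hypothesis gfT : (g *m f^T)^T = - (g *m f^T).
Hypotheses (Lz1 : L *m z1^T = 0) (Lz2 : L *m z2^T = 0).
Hypotheses (zb11 : z1 *m b1^T = 1%:M) (zb22 : z2 *m b2^T = 1%:M).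
Hypothesis ff : f *m f = - 1%:M + b1^T *m z1 + b2^T *m z2.
Hypothesis LH : L *m f^T + g *m H^T = 0.
Hypothesis Hf : H *m f + f *m H = 0.

(* f, L and H stand for phi, L_Z g and L_Z phi; S is the g-symmetric part of
   nabla Z. *)
Let S := 2^-1 *: L *m invmx g.

Lemma shape_mul_metric : S *m g = 2^-1 *: L.
Proof. by rewrite /S mulmxKV. Qed.

Lemma mul_reeb_shape z : L *m z^T = 0 -> z *m S = 0.
Proof.
move=> Lz; have zL : z *m L = 0.
  by apply: trmx_inj; rewrite trmx_mul LT Lz trmx0.
by rewrite /S mulmxA -scalemxAr zL scaler0 mul0mx.
Qed.

Lemma lie_endo_shape : H = - 2 *: (f *m S).
Proof.
have : L *m f^T = - (g *m H^T) by apply/eqP; rewrite -addr_eq0 LH.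
move/(congr1 trmx); rewrite trmxN !trmx_mul !trmxK LT gT => fL.
have -> : H = - (- (H *m g)) *m invmx g by rewrite opprK mulmxK.
rewrite -fL /S mulNmx -[2^-1 *: L *m _]scalemxAl -scalemxAr scalerA mulmxA.
by rewrite mulNr divff ?pnatr_eq0 // scaleN1r.
Qed.

(** Anticommutation turns f S f into - f f S, and f f + Id takes values in the span of the Reeb
    vectors, which S kills. *)
Lemma endo_shape_endo : f *m S *m f = S.
Proof.
have ffS : f *m f *m S = - S.
  rewrite ff !mulmxDl -!mulmxA (mul_reeb_shape Lz1) (mul_reeb_shape Lz2).
  by rewrite !mulmx0 !addr0 mulNmx mul1mx.
move: Hf; rewrite lie_endo_shape -scalemxAl -scalemxAr -scalerDr => /eqP.
rewrite scaler_eq0 oppr_eq0 pnatr_eq0 /= (mulmxA f f S) ffS subr_eq0.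
by move/eqP.
Qed.

(** Skewness for g makes the transpose of phi conjugate to - phi. This kills tr phi and, S being
    symmetric, also tr (S phi). *)
Lemma endo_tr : f^T = - (invmx g *m f *m g).
Proof.
have := gfT; rewrite trmx_mul trmxK gT => fg.
by rewrite -mulmxA fg mulmxN opprK mulKmx.
Qed.

Lemma shape_tr : S^T = invmx g *m S *m g.
Proof.
by rewrite -mulmxA shape_mul_metric /S trmx_mul trmxZ LT trmx_inv gT.
Qed.

Lemma mxtrace_endo : \tr f = 0.
Proof.
have : \tr f = - \tr f.
  rewrite -[LHS]mxtrace_tr endo_tr raddfN /= mxtrace_mulC mulmxA.
  by rewrite mulmxV ?mul1mx.
move/eqP; rewrite -addr_eq0 -mulr2n mulrn_eq0 /=.
by move/eqP.
Qed.

Lemma mxtrace_shape : \tr S = 0.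
Proof.
have trff : \tr (f *m f *m S) = - \tr S.
  rewrite ff !mulmxDl -!mulmxA (mul_reeb_shape Lz1) (mul_reeb_shape Lz2).
  by rewrite !mulmx0 !addr0 mulNmx mul1mx raddfN.
have : \tr S = - \tr S.
  by rewrite -{1}endo_shape_endo mxtrace_mulC mulmxA trff.
move/eqP; rewrite -addr_eq0 -mulr2n mulrn_eq0 /=.
by move/eqP.
Qed.

Lemma mxtrace_shape_endo : \tr (S *m f) = 0.
Proof.
move: shape_tr; move: S => B BT.
have : \tr (B *m f) = - \tr (B *m f).
  rewrite -[LHS]mxtrace_tr trmx_mul endo_tr BT mulNmx raddfN /= !mulmxA.
  by rewrite mulmxK // mxtrace_mulC -(mulmxA (invmx g)) mulKVmx // mxtrace_mulC.
move/eqP; rewrite -addr_eq0 -mulr2n mulrn_eq0 /=.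
by move/eqP.
Qed.

Lemma mxtrace_lie_endo_sqr :
  \tr ((2^-1 *: H) *m (2^-1 *: H)) = \tr (S *m S).
Proof.
have -> : 2^-1 *: H = - (f *m S).
  by rewrite lie_endo_shape scalerA mulrN mulVf ?pnatr_eq0 // scaleN1r.
by rewrite mulNmx mulmxN opprK mulmxA endo_shape_endo.
Qed.

(** The cross terms have trace zero; the 2 counts the projections onto the two Reeb directions in
    phi^2. *)
Lemma mxtrace_nabla_sqr :
  \tr ((S - f) *m (S - f)) = \tr (S *m S) - n%:R + 2.
Proof.
rewrite mulmxBl !mulmxBr !raddfB /= (mxtrace_mulC f S) mxtrace_shape_endo.
rewrite ff !mxtraceD [\tr (- _)]raddfN /= mxtrace1.
rewrite (mxtrace_outer zb11) (mxtrace_outer zb22).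
ring.
Qed.

Lemma mxtrace_shape_sqr_eq0 (e : 'I_n -> 'rV[R]_n) :
  (forall u, u != 0 -> 0 < pair2 g u u) -> orthonormal g e ->
  \tr (S *m S) = 0 <-> L = 0.
Proof.
move=> gpos eo; split=> [trS|L0]; last first.
  by rewrite /S L0 scaler0 !mul0mx mxtrace0.
have S0 : S = 0.
  apply: (sym_sqr_mxtrace0 eo gpos _ gT trS).
  by rewrite shape_mul_metric trmxZ LT.
have := shape_mul_metric; rewrite S0 mul0mx => /esym/eqP.
by rewrite scaler_eq0 invr_eq0 pnatr_eq0 /= => /eqP.
Qed.

End ContactAlgebra.

(** * Metric contact pairs in coordinates *)

Section LieAlgebra.
Context {R : realType} {n : nat}.
(** Values at one point: [D] and [Df] are the derivatives of g and phi along Z, [J], [J1], [J2] the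
    Jacobians of Z, Z1, Z2, and [K1], [K2] those of al1, al2 as rows. *)
Variables (g f D Df J J1 J2 K1 K2 : 'M[R]_n) (z z1 z2 b1 b2 : 'rV[R]_n).

(** Leibniz rule for g(., Z1) = al1: both al1 and Z1 are invariant under Z, the latter in the form
    [Z, Z1] = 0. *)
Lemma lie_metric_reeb_alg :
  g *m z1^T = b1^T -> D *m z1^T + g *m (z *m J1)^T = (z *m K1)^T ->
  b1 *m J^T + z *m K1 = 0 -> z *m J1 = z1 *m J ->
  (D + J *m g + g *m J^T) *m z1^T = 0.
Proof.
move=> gz E fb zJ; apply: trmx_inj; rewrite trmx0 -[RHS]fb.
rewrite -[z *m K1]trmxK -E zJ; rewrite !mulmxDl -!mulmxA gz.
by apply: trmx_inj; mx_ring.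
Qed.

Lemma lie_metric_endo_alg (W DW : 'M[R]_n) :
  W = g *m f^T -> DW + J *m W + W *m J^T = 0 -> DW = D *m f^T + g *m Df^T ->
  (D + J *m g + g *m J^T) *m f^T + g *m (Df - f *m J + J *m f)^T = 0.
Proof. by move=> -> E DWE; rewrite -[RHS]E DWE; mx_ring. Qed.

Lemma lie_endo_anticomm_alg :
  f *m f = - 1%:M + b1^T *m z1 + b2^T *m z2 ->
  Df *m f + f *m Df = (z *m K1)^T *m z1 + b1^T *m (z *m J1) +
    ((z *m K2)^T *m z2 + b2^T *m (z *m J2)) ->
  b1 *m J^T + z *m K1 = 0 -> b2 *m J^T + z *m K2 = 0 ->
  z *m J1 = z1 *m J -> z *m J2 = z2 *m J ->
  (Df - f *m J + J *m f) *m f + f *m (Df - f *m J + J *m f) = 0.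
Proof.
move=> ff Dff f1 f2 zJ1 zJ2.
have e b K : b *m J^T + z *m K = 0 -> (z *m K)^T = - (J *m b^T).
  move=> /eqP; rewrite addrC addr_eq0 => /eqP ->.
  by rewrite trmxN trmx_mul trmxK.
have -> : (Df - f *m J + J *m f) *m f + f *m (Df - f *m J + J *m f) =
    Df *m f + f *m Df + (J *m (f *m f) - f *m f *m J) by mx_ring.
rewrite Dff ff zJ1 zJ2 (e _ _ f1) (e _ _ f2); mx_ring.
Qed.

Lemma lie_closed_formD (W W1 W2 D1 D2 : 'M[R]_n) :
  D1 + J *m W1 + W1 *m J^T = 0 -> D2 + J *m W2 + W2 *m J^T = 0 ->
  W = W1 + W2 -> D1 + D2 + J *m W + W *m J^T = 0.
Proof. by move=> L1 L2 ->; rewrite -[RHS]addr0 -{1}L1 -L2; mx_ring. Qed.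

(** [Q] is the gradient of g contracted with Z, and the second hypothesis differentiates al1 + al2 =
    g(Z, .). The conclusion splits the lowered nabla Z into its symmetric part, half of L_Z g, and
    its skew part, d(al1 + al2). *)
Lemma nabla_alg Q :
  g^T = g -> K1 + K2 = J *m g + Q ->
  J *m g + 2^-1 *: (D + Q - Q^T) = 2^-1 *: (D + J *m g + g *m J^T) +
    (2^-1 *: (K1 - K1^T) + 2^-1 *: (K2 - K2^T)).
Proof.
move=> gT KQ.
have -> : K1 = J *m g + Q - K2 by rewrite -KQ addrK.
have -> : g *m J^T = (J *m g)^T by rewrite trmx_mul gT.
move: (J *m g) => P; mx_ring.
Qed.

End LieAlgebra.

Section LocalContact.
Context {R : realType} {n : nat} {U : set 'rV[R]_n} (oU : open U).
Local Notation E := 'rV[R]_n.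
Variables (z1 z2 b1 b2 : E -> E) (f g : E -> 'M[R]_n).
Hypotheses (sz1 : smooth_on U z1) (sz2 : smooth_on U z2).
Hypotheses (sb1 : smooth_on U b1) (sb2 : smooth_on U b2).
Hypotheses (sf : smooth_on U f) (sg : smooth_on U g).
Hypothesis zb11 : forall y, U y -> z1 y *m (b1 y)^T = 1%:M.
Hypothesis zb12 : forall y, U y -> z1 y *m (b2 y)^T = 0.
Hypothesis zb21 : forall y, U y -> z2 y *m (b1 y)^T = 0.
Hypothesis zb22 : forall y, U y -> z2 y *m (b2 y)^T = 1%:M.
Hypothesis zd11 : forall y, U y -> z1 y *m extd_mx b1 y = 0.
Hypothesis zd12 : forall y, U y -> z1 y *m extd_mx b2 y = 0.
Hypothesis zd21 : forall y, U y -> z2 y *m extd_mx b1 y = 0.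
Hypothesis zd22 : forall y, U y -> z2 y *m extd_mx b2 y = 0.
Hypothesis ff : forall y, U y ->
  f y *m f y = - 1%:M + (b1 y)^T *m z1 y + (b2 y)^T *m z2 y.
Hypothesis z1f : forall y, U y -> z1 y *m f y = 0.
Hypothesis z2f : forall y, U y -> z2 y *m f y = 0.
Hypothesis gf : forall y, U y -> g y *m (f y)^T = extd_mx b1 y + extd_mx b2 y.
Hypothesis gz1 : forall y, U y -> g y *m (z1 y)^T = (b1 y)^T.
Hypothesis gz2 : forall y, U y -> g y *m (z2 y)^T = (b2 y)^T.
Hypothesis gT : forall y, U y -> (g y)^T = g y.
Hypothesis gpos : forall y, U y -> forall u, u != 0 -> 0 < pair2 (g y) u u.

Let gU y : U y -> g y \in unitmx.
Proof. by move=> Uy; apply: posdef_unitmx; exact: gpos. Qed.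

Let gfT y : U y -> (g y *m (f y)^T)^T = - (g y *m (f y)^T).
Proof.
move=> Uy; rewrite (gf Uy); have := extd_mxT b1 y; have := extd_mxT b2 y.
move: (extd_mx b1 y) (extd_mx b2 y) => A B BT AT.
by rewrite trmxD AT BT opprD.
Qed.

(** The bracket w of Z1 and Z2 is annihilated by al1, al2 and their differentials. Hence g(w, phi .)
    = 0, so g(w, phi^2 .) = 0; the Reeb terms of phi^2 contribute al1(w) = al2(w) = 0, leaving g(w,
    .) = 0. *)
Lemma reeb_commute x : U x -> z1 x *m jacobian z2 x = z2 x *m jacobian z1 x.
Proof.
move=> Ux; apply/eqP; rewrite -subr_eq0; apply/eqP.
have w1 := bracket_extd oU sz1 sz2 sb1 zd11 zd21 Ux.
have w2 := bracket_extd oU sz1 sz2 sb2 zd12 zd22 Ux.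
have v1 := bracket_form_alg (lie_form oU sz1 sb1 zb11 Ux (zd11 Ux))
  (lie_form oU sz2 sb1 zb21 Ux (zd21 Ux)) (zd11 Ux) (zd21 Ux).
have v2 := bracket_form_alg (lie_form oU sz1 sb2 zb12 Ux (zd12 Ux))
  (lie_form oU sz2 sb2 zb22 Ux (zd22 Ux)) (zd12 Ux) (zd22 Ux).
move: w1 w2 v1 v2.
move: (z1 x *m jacobian z2 x - z2 x *m jacobian z1 x) => w w1 w2 v1 v2.
have : w *m (g x *m (f x)^T) *m (f x)^T = 0.
  rewrite (gf Ux); move: w1 w2; move: (extd_mx b1 x) (extd_mx b2 x).
  by move=> W1 W2 w1 w2; rewrite mulmxDr w1 w2 addr0 mul0mx.
have -> : w *m (g x *m (f x)^T) *m (f x)^T = w *m g x *m (f x *m f x)^T.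
  by rewrite trmx_mul !mulmxA.
rewrite (ff Ux) !trmxD !trmx_mul !trmxK trmxN trmx1 !mulmxDr mulmxN mulmx1.
rewrite -!mulmxA ![g x *m (_ *m _)]mulmxA (gz1 Ux) (gz2 Ux) !(mulmxA w) v1 v2.
rewrite !mul0mx !addr0 => /eqP; rewrite oppr_eq0 => /eqP wg.
by rewrite -[w](mulmxK (gU Ux)) wg mul0mx.
Qed.

Variables (z : E -> E) (sz : smooth_on U z).
Hypothesis zE : forall y, z y = z1 y + z2 y.

Let jacobian_reeb x : U x -> jacobian z x = jacobian z1 x + jacobian z2 x.
Proof.
move=> Ux; have -> : z = fun y => z1 y + z2 y by apply/funext.
exact: (jacobianD oU sz1 sz2 Ux).
Qed.

Let zb1 y : U y -> z y *m (b1 y)^T = 1%:M.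
Proof. by move=> Uy; rewrite zE mulmxDl zb11 // zb21 // addr0. Qed.

Let zb2 y : U y -> z y *m (b2 y)^T = 1%:M.
Proof. by move=> Uy; rewrite zE mulmxDl zb12 // zb22 // add0r. Qed.

Let zd1 y : U y -> z y *m extd_mx b1 y = 0.
Proof. by move=> Uy; rewrite zE mulmxDl zd11 // zd21 // addr0. Qed.

Let zd2 y : U y -> z y *m extd_mx b2 y = 0.
Proof. by move=> Uy; rewrite zE mulmxDl zd12 // zd22 // addr0. Qed.

Definition lie_metric_mx y : 'M[R]_n :=
  'D_(z y) g y + jacobian z y *m g y + g y *m (jacobian z y)^T.

Definition lie_endo_mx y : 'M[R]_n :=
  'D_(z y) f y - f y *m jacobian z y + jacobian z y *m f y.

Lemma lie_metric_mxT y : U y -> (lie_metric_mx y)^T = lie_metric_mx y.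
Proof.
move=> Uy; have := derive_sym oU sg gT (z y) Uy; rewrite /lie_metric_mx.
move: ('D_(z y) g y) (jacobian z y) => D J DT.
by rewrite !trmxD !trmx_mul !trmxK (gT Uy) DT -!addrA (addrC (J *m _)).
Qed.

Let zJ1 x : U x -> z x *m jacobian z1 x = z1 x *m jacobian z x.
Proof.
move=> Ux; rewrite zE (jacobian_reeb Ux); have := reeb_commute Ux.
move: (jacobian z1 x) (jacobian z2 x) => J1 J2 H.
by rewrite mulmxDr mulmxDl H.
Qed.

Let zJ2 x : U x -> z x *m jacobian z2 x = z2 x *m jacobian z x.
Proof.
move=> Ux; rewrite zE (jacobian_reeb Ux); have := reeb_commute Ux.
move: (jacobian z1 x) (jacobian z2 x) => J1 J2 H.
by rewrite mulmxDr mulmxDl H.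
Qed.

Let derive_lowering (w b : E -> E) x : smooth_on U w -> smooth_on U b ->
  (forall y, U y -> g y *m (w y)^T = (b y)^T) -> U x ->
  'D_(z x) g x *m (w x)^T + g x *m (z x *m jacobian w x)^T =
  (z x *m jacobian b x)^T.
Proof.
move=> sw sb gw Ux.
have ew := mul_jacobian (z x) sw Ux; have eb := mul_jacobian (z x) sb Ux.
have [_ D] := is_derive_mulmx (smooth_is_derive (z x) sg Ux)
  (is_derive_trmx (smooth_is_derive (z x) sw Ux)).
have [_ D'] := is_derive_trmx (smooth_is_derive (z x) sb Ux).
have := etrans (esym D) (etrans (derive_eq_on oU _ Ux gw) D').
move: ew eb; move: (z x) (jacobian w x) (jacobian b x) => c Jw Jb.
by move=> <- <-.
Qed.

Lemma lie_metric_reeb1 x : U x -> lie_metric_mx x *m (z1 x)^T = 0.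
Proof.
move=> Ux; exact: (lie_metric_reeb_alg (gz1 Ux) (derive_lowering sz1 sb1 gz1 Ux)
  (lie_form oU sz sb1 zb1 Ux (zd1 Ux)) (zJ1 Ux)).
Qed.

Lemma lie_metric_reeb2 x : U x -> lie_metric_mx x *m (z2 x)^T = 0.
Proof.
move=> Ux; exact: (lie_metric_reeb_alg (gz2 Ux) (derive_lowering sz2 sb2 gz2 Ux)
  (lie_form oU sz sb2 zb2 Ux (zd2 Ux)) (zJ2 Ux)).
Qed.

Lemma lie_metric_endo x : U x ->
  lie_metric_mx x *m (f x)^T + g x *m (lie_endo_mx x)^T = 0.
Proof.
move=> Ux.
have [e1 _] := is_derive_extd oU (z x) sb1 Ux.
have [e2 _] := is_derive_extd oU (z x) sb2 Ux.
have [_ D] := is_deriveD (derivableP e1) (derivableP e2).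
have [_ D'] := is_derive_mulmx (smooth_is_derive (z x) sg Ux)
  (is_derive_trmx (smooth_is_derive (z x) sf Ux)).
apply: (lie_metric_endo_alg (erefl _) _
  (etrans (esym D) (etrans (esym (derive_eq_on oU _ Ux gf)) D'))).
exact: (lie_closed_formD (lie_extd oU sz sb1 zd1 Ux)
  (lie_extd oU sz sb2 zd2 Ux) (gf Ux)).
Qed.

Lemma lie_endo_anticomm x : U x ->
  lie_endo_mx x *m f x + f x *m lie_endo_mx x = 0.
Proof.
move=> Ux; apply: (lie_endo_anticomm_alg (ff Ux) _
  (lie_form oU sz sb1 zb1 Ux (zd1 Ux)) (lie_form oU sz sb2 zb2 Ux (zd2 Ux))
  (zJ1 Ux) (zJ2 Ux)).
have ez1 := mul_jacobian (z x) sz1 Ux; have ez2 := mul_jacobian (z x) sz2 Ux.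
have eb1 := mul_jacobian (z x) sb1 Ux; have eb2 := mul_jacobian (z x) sb2 Ux.
have df := smooth_is_derive (z x) sf Ux.
have [_ D] := is_derive_mulmx df df.
have [d1 D1] := is_derive_mulmx
  (is_derive_trmx (smooth_is_derive (z x) sb1 Ux))
  (smooth_is_derive (z x) sz1 Ux).
have [d2 D2] := is_derive_mulmx
  (is_derive_trmx (smooth_is_derive (z x) sb2 Ux))
  (smooth_is_derive (z x) sz2 Ux).
have [_ D'] := is_deriveD (is_deriveD (is_derive_cst (- 1%:M : 'M[R]_n) x (z x))
  (derivableP d1)) (derivableP d2).
have := etrans (esym D) (etrans (derive_eq_on oU _ Ux ff) D').
rewrite D1 D2 add0r; move: ez1 ez2 eb1 eb2; move: (z x).
move: (jacobian z1 x) (jacobian z2 x) (jacobian b1 x) (jacobian b2 x).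
by move=> J1 J2 K1 K2 c <- <- <- <-.
Qed.

Lemma nabla_shape x : U x ->
  nabla_mx g z x = 2^-1 *: lie_metric_mx x *m invmx (g x) - f x.
Proof.
move=> Ux.
(* Product rule for the metric dual al1 + al2 = g(Z, .), the only place where the Koszul terms meet
   the contact forms. *)
have KQ : jacobian b1 x + jacobian b2 x =
    jacobian z x *m g x + grad g (z x) x.
  apply/eqP; rewrite -subr_eq0; apply/eqP/mulmx_row_eq0 => u.
  have bE y : U y -> b1 y + b2 y = z y *m g y.
    move=> Uy; apply: trmx_inj.
    by rewrite trmxD trmx_mul (gT Uy) zE trmxD mulmxDr (gz1 Uy) (gz2 Uy).
  have [_ D] := is_derive_mulmx (smooth_is_derive u sz Ux)
    (smooth_is_derive u sg Ux).
  have [_ D'] := is_deriveD (smooth_is_derive u sb1 Ux)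
    (smooth_is_derive u sb2 Ux).
  have := etrans (esym D') (etrans (derive_eq_on oU _ Ux bE) D).
  have eg := mul_grad (z x) u sg Ux; have ez := mul_jacobian u sz Ux.
  have e1 := mul_jacobian u sb1 Ux; have e2 := mul_jacobian u sb2 Ux.
  move: eg ez e1 e2.
  move: (jacobian b1 x) (jacobian b2 x) (jacobian z x) (grad g (z x) x).
  move=> K1 K2 J Q <- <- <- <- H.
  by rewrite mulmxBr !mulmxDr H mulmxA subrr.
have Ag : nabla_mx g z x *m g x = 2^-1 *: lie_metric_mx x + g x *m (f x)^T.
  rewrite (gf Ux) /nabla_mx mulmxDl (lowered_christoffel_mul gU (z x) Ux).
  exact: nabla_alg (gT Ux) KQ.
have fg : g x *m (f x)^T = - (f x *m g x).
  by have := gfT Ux; rewrite trmx_mul trmxK (gT Ux) => ->; rewrite opprK.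
rewrite -[LHS](mulmxK (gU Ux)) Ag fg; move: (lie_metric_mx x) => L.
by rewrite mulmxBl (mulmxK (gU Ux)).
Qed.

Lemma nabla_reeb x : U x -> z x *m nabla_mx g z x = 0.
Proof.
move=> Ux; rewrite (nabla_shape Ux) mulmxBr zE mulmxDl.
rewrite (mul_reeb_shape (g x) (lie_metric_mxT Ux) (lie_metric_reeb1 Ux)).
rewrite (mul_reeb_shape (g x) (lie_metric_mxT Ux) (lie_metric_reeb2 Ux)).
by rewrite mulmxDl z1f // z2f // !addr0 subr0.
Qed.

Lemma mxtrace_nabla x : U x -> \tr (nabla_mx g z x) = 0.
Proof.
move=> Ux; rewrite (nabla_shape Ux) raddfB /=.
rewrite (mxtrace_endo (gT Ux) (gU Ux) (gfT Ux)) subr0.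
exact: (mxtrace_shape (gT Ux) (gU Ux) (lie_metric_mxT Ux) (lie_metric_reeb1 Ux)
  (lie_metric_reeb2 Ux) (ff Ux) (lie_metric_endo Ux) (lie_endo_anticomm Ux)).
Qed.

Lemma reeb_sqr_norm x : U x -> pair2 (g x) (z x) (z x) = 2.
Proof.
move=> Ux; rewrite /pair2 -mulmxA {2}zE trmxD mulmxDr gz1 // gz2 //.
by rewrite mulmxDr zb1 // zb2 // !mxE.
Qed.

Let lie_endo_sqr x (Ux : U x) := mxtrace_lie_endo_sqr (gT Ux) (gU Ux)
  (lie_metric_mxT Ux) (lie_metric_reeb1 Ux) (lie_metric_reeb2 Ux) (ff Ux)
  (lie_metric_endo Ux) (lie_endo_anticomm Ux).

Lemma ricci_reeb x (e : 'I_n.-1 -> E) : U x ->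
  orthonormal (g x) e -> (forall i, pair2 (g x) (z x) (e i) = 0) ->
  \sum_i pair2 (curvature_mx g (z x) (e i) x *m g x) (e i) (z x) =
  n%:R - 2 - \tr ((2^-1 *: lie_endo_mx x) *m (2^-1 *: lie_endo_mx x)).
Proof.
move=> Ux eo ze.
have z0 : z x != 0.
  apply/eqP => z0; have := reeb_sqr_norm Ux.
  by rewrite z0 /pair2 !mul0mx mxE => /eqP; rewrite eq_sym pnatr_eq0.
rewrite (geodesic_ricci oU sg gT gpos sz nabla_reeb mxtrace_nabla Ux z0 eo ze).
rewrite (nabla_shape Ux) (lie_endo_sqr Ux).
rewrite (mxtrace_nabla_sqr (gT Ux) (gU Ux) (lie_metric_mxT Ux) (gfT Ux)
  (zb11 Ux) (zb22 Ux) (ff Ux)).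
by move: (\tr _) => t; ring.
Qed.

Lemma lie_endo_sqr_eq0 x (e : 'I_n -> E) : U x -> orthonormal (g x) e ->
  \tr ((2^-1 *: lie_endo_mx x) *m (2^-1 *: lie_endo_mx x)) = 0 <->
  lie_metric_mx x = 0.
Proof.
move=> Ux eo; rewrite (lie_endo_sqr Ux).
exact: (mxtrace_shape_sqr_eq0 (gT Ux) (gU Ux) (lie_metric_mxT Ux) (gpos Ux) eo).
Qed.

End LocalContact.

(** * Tensor fields read in a chart *)

Section Chart.
Context {R : realType} {n : nat} {M : manifold R n}.
Local Notation E := 'rV[R]_n.
Variable a : chart M.

Definition chart_image : set E := coord a @` chart_dom a.
Local Notation U := chart_image.

Lemma open_chart_image : open U.
Proof. exact: coord_open. Qed.

Lemma chart_imageP x : U x ->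
  chart_dom a (coordV a x) /\ coord a (coordV a x) = x.
Proof. by move=> [p pa <-]; rewrite (coordK pa). Qed.

Lemma coord_image p : chart_dom a p -> U (coord a p).
Proof. by move=> pa; exists p. Qed.

Lemma derive_pair2 (G : E -> 'M[R]_n) u v x w : derivable G x w ->
  'D_w (fun y => pair2 (G y) u v) x = pair2 ('D_w G x) u v.
Proof.
move=> dG.
have d := is_derive_mulmx (is_derive_mulmx (is_derive_cst u x w)
  (derivableP dG)) (is_derive_cst v^T x w).
have [_ ->] := is_derive_mxE 0 0 d.
by rewrite mulmx0 addr0 mul0mx add0r.
Qed.

Lemma dd_cst (W : normedModType R) (c : W) p v : dd a (cst c) p v = 0.
Proof. exact: derive_cst. Qed.

Lemma bracket_cst (u v : E) p : bracket a (cst u) (cst v) p = 0.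
Proof. by rewrite /bracket !dd_cst subrr. Qed.

Lemma ext_dE (al : chart M -> M -> 'cV[R]_n) p u v :
  smooth_in a (al a) -> chart_dom a p ->
  ext_d al a p u v =
    pair2 (extd_mx (fun y => (al a (coordV a y))^T) (coord a p)) u v.
Proof.
move=> sal pa; have Ux := coord_image pa.
set b := fun y => _; have sb : smooth_on U b.
  exact: (smooth_trmx open_chart_image sal).
have D w c : dd a (fun q => pair1 (al a q) c) p w =
    (w *m jacobian b (coord a p) *m c^T) 0 0.
  rewrite (mul_jacobian w sb Ux).
  have d := is_derive_mulmx (smooth_is_derive w sb Ux)
    (is_derive_cst c^T (coord a p) w).
  have [_] := is_derive_mxE 0 0 d; rewrite mulmx0 addr0 => <-.
  apply: (derive_eq_on open_chart_image) => // y _ /=.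
  by rewrite /pair1 /b -[in RHS]trmx_mul trmx11.
have p0 : pair1 (al a p) 0 = 0 by rewrite /pair1 mul0mx mxE.
rewrite /ext_d /= !D bracket_cst p0 subr0.
rewrite /extd_mx; move: (jacobian b (coord a p)) => K.
rewrite /pair2 -scalemxAr -scalemxAl mulmxBr mulmxBl.
have -> : u *m K^T *m v^T = v *m K *m u^T.
  by rewrite -[LHS]trmx11 !trmx_mul !trmxK mulmxA.
by rewrite !mxE.
Qed.

Section LieDerivatives.
Variables (Z : chart M -> M -> E) (sZ : smooth_in a (Z a)).
Let z := Z a \o coordV a.
Let sz : smooth_on U z := sZ.

Lemma lie_endoE (phi : chart M -> M -> 'M[R]_n) p :
  smooth_in a (phi a) -> chart_dom a p ->
  lie_endo Z phi a p = lie_endo_mx (phi a \o coordV a) z (coord a p).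
Proof.
move=> sphi pa; have Ux := coord_image pa.
set x := coord a p in Ux *; set f := phi a \o coordV a.
have sf : smooth_on U f := sphi.
have fx : f x = phi a p by rewrite /f /x /= (coordK pa).
have zx : z x = Z a p by rewrite /z /x /= (coordK pa).
apply/matrixP => i j; rewrite [LHS]mxE /=; set u := delta_mx 0 i.
have -> : bracket a (Z a) (cst u) p = - (u *m jacobian z x).
  by rewrite (mul_jacobian u sz Ux) /bracket dd_cst sub0r.
have -> : bracket a (Z a) (fun q => cst u q *m phi a q) p =
    u *m 'D_(z x) f x - u *m f x *m jacobian z x.
  rewrite (mul_jacobian _ sz Ux) fx zx.
  have d := is_derive_mulmx (is_derive_cst u x (z x))
    (smooth_is_derive (z x) sf Ux).
  have [_] := d; rewrite mul0mx add0r zx => <-.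
  by [].
rewrite -fx /lie_endo_mx; move: ('D_(z x) f x) (jacobian z x) (f x) => Df J F.
rewrite mulNmx opprK -!mulmxA -mulmxBr -mulmxDr.
by rewrite /u -rowE mxE.
Qed.

Lemma lie_metricE (g : chart M -> M -> 'M[R]_n) p u v :
  smooth_in a (g a) -> chart_dom a p ->
  lie_metric Z g a p u v =
    pair2 (lie_metric_mx (g a \o coordV a) z (coord a p)) u v.
Proof.
move=> sg' pa; have Ux := coord_image pa.
set x := coord a p in Ux *; set g' := g a \o coordV a.
have sg : smooth_on U g' := sg'.
have gx : g' x = g a p by rewrite /g' /x /= (coordK pa).
have zx : z x = Z a p by rewrite /z /x /= (coordK pa).
have E w : bracket a (Z a) (cst w) p = - (w *m jacobian z x).
  by rewrite (mul_jacobian w sz Ux) /bracket dd_cst sub0r.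
have [dg _] := smooth_is_derive (z x) sg Ux.
have D := derive_pair2 u v dg.
rewrite /lie_metric /= !E.
have -> : dd a (fun q => pair2 (g a q) u v) p (Z a p) =
  pair2 ('D_(z x) g' x) u v by rewrite -D zx.
rewrite /lie_metric_mx -gx; move: ('D_(z x) g' x) (jacobian z x) (g' x).
move=> Dg J G; rewrite /pair2.
have -> : u *m (Dg + J *m G + G *m J^T) *m v^T = u *m Dg *m v^T -
    - (u *m J) *m G *m v^T - u *m G *m (- (v *m J))^T by mx_ring.
move: (_ *m Dg *m _) (- _ *m _ *m _) (_ *m (- _)^T) => A B C.
by rewrite !mxE.
Qed.

End LieDerivatives.

Section Curvature.
Variables (g : chart M -> M -> 'M[R]_n) (rg : riemannian_metric g).
Let g' := g a \o coordV a.

Let sg : smooth_on U g'.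
Proof. by case: rg => sm _ _ _; exact: sm. Qed.

Lemma metric_sym y : U y -> (g' y)^T = g' y.
Proof.
move=> /chart_imageP[ya _]; case: rg => _ _ gC _.
apply/matrixP => i j; rewrite mxE.
have E k l : pair2 (g' y) (delta_mx 0 k) (delta_mx 0 l) = g' y k l.
  by rewrite /pair2 -rowE trmx_delta -colE !mxE.
by rewrite -!E; exact: gC.
Qed.

Lemma metric_pos y : U y -> forall u, u != 0 -> 0 < pair2 (g' y) u u.
Proof. by move=> /chart_imageP[ya _]; case: rg => _ _ _ gP u u0; exact: gP. Qed.

Lemma christoffelE q u v : chart_dom a q ->
  christoffel g a q u v = v *m christoffel_mx g' u (coord a q).
Proof.
move=> qa; have Ux := coord_image qa.
set x := coord a q in Ux *.
have gx : g' x = g a q by rewrite /g' /x /= (coordK qa).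
have D w c c' : dd a (fun q => pair2 (g a q) c c') q w =
    pair2 ('D_w g' x) c c'.
  by have [dg _] := smooth_is_derive w sg Ux; exact: (derive_pair2 c c' dg).
rewrite /christoffel /christoffel_mx mulmxA -gx; congr (_ *m _).
apply/rowP => l; rewrite mxE !D /lowered_christoffel.
have e1 := mul_grad u v sg Ux; have e2 := mul_grad u (delta_mx 0 l) sg Ux.
move: e1 e2; move: ('D_u g' x) ('D_v g' x) ('D_(delta_mx 0 l) g' x).
move: (grad g' u x) => Q Du Dv Dl e1 e2.
rewrite -scalemxAr mulmxBr mulmxDr e1 !mxE.
congr (_ * (_ + _ - _)).
- by rewrite /pair2 trmx_delta -colE !mxE.
- by rewrite /pair2 trmx_delta -colE !mxE.
rewrite /pair2 -e2 -rowE !mxE; apply: eq_bigr => k _; rewrite !mxE.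
exact: mulrC.
Qed.

Lemma riemannE p u v w : chart_dom a p ->
  riemann g a p u v w = w *m curvature_mx g' u v (coord a p).
Proof.
move=> pa; have Ux := coord_image pa.
have oU := open_chart_image.
have gU y : U y -> g' y \in unitmx.
  by move=> Uy; apply: posdef_unitmx; exact: metric_pos.
have nE s t q : chart_dom a q ->
    nabla g a (cst s) (cst t) q = t *m christoffel_mx g' s (coord a q).
  by move=> qa; rewrite /nabla dd_cst add0r christoffelE.
have nn s t : nabla g a (cst s) (nabla g a (cst t) (cst w)) p =
    w *m 'D_s (christoffel_mx g' t) (coord a p) +
    w *m christoffel_mx g' t (coord a p) *m christoffel_mx g' s (coord a p).
  rewrite {1}/nabla christoffelE // nE //; congr (_ + _).
  have d := is_derive_mulmx (is_derive_cst w (coord a p) s)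
    (derivableP (@derivable_christoffel _ _ _ oU _ sg gU t (coord a p) s Ux)).
  have [_] := d; rewrite mul0mx add0r => <-.
  apply: (derive_eq_on oU) => // y /chart_imageP[ya yE] /=.
  by rewrite nE // yE.
have n0 : nabla g a (bracket a (cst u) (cst v)) (cst w) p = 0.
  rewrite /nabla dd_cst add0r bracket_cst christoffelE //.
  (* Symmetry moves the zero vector from the direction slot to the left of a matrix product. *)
  by rewrite (christoffel_mxC oU sg metric_sym 0 w Ux) mul0mx.
rewrite /riemann /= !nn n0 subr0 /curvature_mx.
move: (christoffel_mx g' u _) (christoffel_mx g' v _) => Gu Gv.
move: ('D_u _ _) ('D_v _ _) => Du Dv; mx_ring.
Qed.

End Curvature.
End Chart.

(** * Metric contact pairs *)

Section Pairings.
Context {R : realType} {n : nat}.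

Lemma pair1E (al : 'cV[R]_n) u : u *m al = (pair1 al u)%:M.
Proof. exact: mx11_scalar. Qed.

Lemma pair2E (W : 'M[R]_n) u v : u *m W *m v^T = (pair2 W u v)%:M.
Proof. exact: mx11_scalar. Qed.

Lemma pair2D (W W' : 'M[R]_n) u v :
  pair2 (W + W') u v = pair2 W u v + pair2 W' u v.
Proof. by rewrite /pair2 mulmxDr mulmxDl mxE. Qed.

Lemma pair2_eq0 (W : 'M[R]_n) u : (forall v, pair2 W u v = 0) -> u *m W = 0.
Proof.
move=> W0; apply: trmx_inj; rewrite trmx0; apply: mulmx_row_eq0 => v.
by rewrite -[LHS]trmx11 trmx_mul trmxK pair2E W0 raddf0.
Qed.

Lemma pair2_inj (W W' : 'M[R]_n) :
  (forall u v, pair2 W u v = pair2 W' u v) -> W = W'.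
Proof.
move=> WW'; apply/eqP; rewrite -subr_eq0; apply/eqP/mulmx_form_eq0 => u v.
by rewrite mulmxBr mulmxBl !pair2E WW' subrr.
Qed.

End Pairings.

Section MetricContactPair.
Context {R : realType} {h k : nat} {M : manifold R (2 * h + 2 * k + 2)}.
Local Notation N := (2 * h + 2 * k + 2)%N.
Variables (al1 al2 : chart M -> M -> 'cV[R]_N).
Variables (Z1 Z2 : chart M -> M -> 'rV[R]_N) (phi g : chart M -> M -> 'M[R]_N).
Hypothesis mcp : metric_contact_pair al1 al2 Z1 Z2 phi g.
Variable a : chart M.
Local Notation U := (chart_image a).

Let oU : open U := @open_chart_image _ _ _ a.
Let Z b p := Z1 b p + Z2 b p.
Let z1 := Z1 a \o coordV a.
Let z2 := Z2 a \o coordV a.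
Let z := Z a \o coordV a.
Let b1 y := (al1 a (coordV a y))^T.
Let b2 y := (al2 a (coordV a y))^T.
Let f := phi a \o coordV a.
Let G := g a \o coordV a.

Let sa1 : smooth_in a (al1 a).
Proof. by case: mcp => -[[[sm _] _ _] _ _ _] _; exact: sm. Qed.

Let sa2 : smooth_in a (al2 a).
Proof. by case: mcp => -[[_ [sm _] _] _ _ _] _; exact: sm. Qed.

Let sz1 : smooth_on U z1.
Proof. by case: mcp => -[_ [[sm _] _ _] _ _] _; exact: sm. Qed.

Let sz2 : smooth_on U z2.
Proof. by case: mcp => -[_ [_ [sm _] _] _ _] _; exact: sm. Qed.

Let sf : smooth_on U f.
Proof. by case: mcp => -[_ _ [sm _] _] _; exact: sm. Qed.

Let rg : riemannian_metric g.
Proof. by case: mcp => _ []. Qed.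

Let sg : smooth_on U G.
Proof. by case: rg => sm _ _ _; exact: sm. Qed.

Let sb1 : smooth_on U b1.
Proof. exact: (smooth_trmx oU sa1). Qed.

Let sb2 : smooth_on U b2.
Proof. exact: (smooth_trmx oU sa2). Qed.

Let sz : smooth_on U z.
Proof. exact: (smooth_onD oU sz1 sz2). Qed.

Let extd1E y u v : U y ->
  ext_d al1 a (coordV a y) u v = pair2 (extd_mx b1 y) u v.
Proof. by move=> /chart_imageP[ya yE]; rewrite (ext_dE u v sa1 ya) yE. Qed.

Let extd2E y u v : U y ->
  ext_d al2 a (coordV a y) u v = pair2 (extd_mx b2 y) u v.
Proof. by move=> /chart_imageP[ya yE]; rewrite (ext_dE u v sa2 ya) yE. Qed.

Let reeb y : U y ->
  [/\ [/\ z1 y *m (b1 y)^T = 1%:M, z1 y *m (b2 y)^T = 0,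
          z2 y *m (b1 y)^T = 0 & z2 y *m (b2 y)^T = 1%:M],
      z1 y *m extd_mx b1 y = 0, z2 y *m extd_mx b1 y = 0,
      z1 y *m extd_mx b2 y = 0 & z2 y *m extd_mx b2 y = 0].
Proof.
move=> Uy; have [ya _] := chart_imageP Uy.
case: mcp => -[_ [_ _ /(_ a _ ya)[[p11 p12 p21 p22] d11 d12 d21 d22]] _ _] _.
split.
- by rewrite /b1 /b2 !trmxK !pair1E p11 p12 p21 p22 raddf0.
- by apply: pair2_eq0 => v; exact: (etrans (esym (extd1E _ v Uy)) (d11 v)).
- by apply: pair2_eq0 => v; exact: (etrans (esym (extd1E _ v Uy)) (d12 v)).
- by apply: pair2_eq0 => v; exact: (etrans (esym (extd2E _ v Uy)) (d21 v)).
- by apply: pair2_eq0 => v; exact: (etrans (esym (extd2E _ v Uy)) (d22 v)).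
Qed.

Let structure y : U y ->
  [/\ f y *m f y = - 1%:M + (b1 y)^T *m z1 y + (b2 y)^T *m z2 y,
      z1 y *m f y = 0 & z2 y *m f y = 0].
Proof.
move=> /chart_imageP[ya _]; case: mcp => -[_ _ _ /(_ a _ ya)[pp p1 p2]] _.
split=> //; apply/eqP; rewrite -subr_eq0; apply/eqP/mulmx_row_eq0 => u.
rewrite mulmxBr !mulmxDr mulmxN mulmx1 !mulmxA pp /b1 /b2 !trmxK !pair1E.
by rewrite !mul_scalar_mx subrr.
Qed.

Let metric y : U y ->
  [/\ G y *m (f y)^T = extd_mx b1 y + extd_mx b2 y,
      G y *m (z1 y)^T = (b1 y)^T & G y *m (z2 y)^T = (b2 y)^T].
Proof.
move=> Uy; have [ya _] := chart_imageP Uy.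
case: mcp => _ [_ /(_ a _ ya)[gp g1 g2]]; split.
- apply: pair2_inj => u v.
  apply: etrans (etrans (gp u v) (etrans
    (congr2 +%R (extd1E u v Uy) (extd2E u v Uy)) (esym (pair2D _ _ _ _)))).
  by rewrite /pair2 trmx_mul !mulmxA.
- apply/eqP; rewrite -subr_eq0; apply/eqP/mulmx_row_eq0 => u.
  by rewrite mulmxBr mulmxA pair2E g1 /b1 trmxK pair1E subrr.
- apply/eqP; rewrite -subr_eq0; apply/eqP/mulmx_row_eq0 => u.
  by rewrite mulmxBr mulmxA pair2E g2 /b2 trmxK pair1E subrr.
Qed.

Let gT := metric_sym (a := a) rg.
Let gpos := metric_pos (a := a) rg.

Definition half_lie_endo p := 2^-1 *: lie_endo Z phi a p.

Let zb11 y : U y -> z1 y *m (b1 y)^T = 1%:M.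
Proof. by move=> /reeb[[]]. Qed.

Let zb12 y : U y -> z1 y *m (b2 y)^T = 0.
Proof. by move=> /reeb[[]]. Qed.

Let zb21 y : U y -> z2 y *m (b1 y)^T = 0.
Proof. by move=> /reeb[[]]. Qed.

Let zb22 y : U y -> z2 y *m (b2 y)^T = 1%:M.
Proof. by move=> /reeb[[]]. Qed.

Let zd11 y : U y -> z1 y *m extd_mx b1 y = 0.
Proof. by move=> /reeb[]. Qed.

Let zd12 y : U y -> z1 y *m extd_mx b2 y = 0.
Proof. by move=> /reeb[]. Qed.

Let zd21 y : U y -> z2 y *m extd_mx b1 y = 0.
Proof. by move=> /reeb[]. Qed.

Let zd22 y : U y -> z2 y *m extd_mx b2 y = 0.
Proof. by move=> /reeb[]. Qed.

Let ff y : U y -> f y *m f y = - 1%:M + (b1 y)^T *m z1 y + (b2 y)^T *m z2 y.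
Proof. by move=> /structure[]. Qed.

Let z1f y : U y -> z1 y *m f y = 0.
Proof. by move=> /structure[]. Qed.

Let z2f y : U y -> z2 y *m f y = 0.
Proof. by move=> /structure[]. Qed.

Let gf y : U y -> G y *m (f y)^T = extd_mx b1 y + extd_mx b2 y.
Proof. by move=> /metric[]. Qed.

Let gz1 y : U y -> G y *m (z1 y)^T = (b1 y)^T.
Proof. by move=> /metric[]. Qed.

Let gz2 y : U y -> G y *m (z2 y)^T = (b2 y)^T.
Proof. by move=> /metric[]. Qed.

Let zE y : z y = z1 y + z2 y. Proof. by []. Qed.

Let norm_reeb x (Ux : U x) : pair2 (G x) (z x) (z x) = 2 :=
  reeb_sqr_norm zb11 zb12 zb21 zb22 gz1 gz2 zE Ux.

Let half_lie_endoE p : chart_dom a p ->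
  half_lie_endo p = 2^-1 *: lie_endo_mx f z (coord a p).
Proof. by move=> pa; rewrite /half_lie_endo (lie_endoE sz sf pa). Qed.

Lemma ricci_direction_reeb p e : chart_dom a p ->
  orthonormal_complement g a p (Z a p) e ->
  ricci_direction g a p (Z a p) e =
    h%:R + k%:R - 2^-1 * \tr (half_lie_endo p *m half_lie_endo p).
Proof.
move=> pa [eo ze]; have Ux := coord_image pa.
set x := coord a p in Ux *.
have Gx : G x = g a p by rewrite /G /x /= (coordK pa).
have zx : z x = Z a p by rewrite /z /x /= (coordK pa).
rewrite -Gx in eo ze; rewrite -zx in ze.
(* The denominator is g(Z, Z) = 2, since [e i] is a unit vector orthogonal to Z. *)
have E i : sectional g a p (Z a p) (e i) =
    2^-1 * pair2 (curvature_mx G (z x) (e i) x *m G x) (e i) (z x).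
  rewrite /sectional (riemannE rg _ _ _ pa) -Gx -zx eo ze (norm_reeb Ux).
  rewrite eqxx expr0n mulr1 subr0 mulrC /pair2; congr (_ * _).
  by rewrite mulmxA.
rewrite /ricci_direction (eq_bigr _ (fun i _ => E i)) -mulr_sumr.
rewrite (ricci_reeb oU sz1 sz2 sb1 sb2 sf sg zb11 zb12 zb21 zb22 zd11 zd12 zd21
  zd22 ff z1f z2f gf gz1 gz2 gT gpos sz zE Ux eo ze).
rewrite (half_lie_endoE pa); move: (\tr _) => t.
by rewrite !natrD; field.
Qed.

Lemma half_lie_endo_sqr_eq0 p : chart_dom a p ->
  \tr (half_lie_endo p *m half_lie_endo p) = 0 <->
  forall u v, lie_metric Z g a p u v = 0.
Proof.
move=> pa; have Ux := coord_image pa.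
have [e eo] := orthonormal_basis_exists (gT Ux) (gpos Ux).
rewrite (half_lie_endoE pa).
have H := lie_endo_sqr_eq0 oU sz1 sz2 sb1 sb2 sf sg zb11 zb12 zb21 zb22
  zd11 zd12 zd21 zd22 ff gf gz1 gz2 gT gpos sz zE Ux eo.
split=> [/H L0 u v|L0].
  have -> := lie_metricE sz u v sg pa.
  move: L0; move: (lie_metric_mx _ _ _) => L ->.
  by rewrite /pair2 mulmx0 mul0mx mxE.
apply/H; apply: pair2_inj => u v.
have := L0 u v; have -> := lie_metricE sz u v sg pa.
by move=> ->; rewrite /pair2 mulmx0 mul0mx mxE.
Qed.

(** The condition Ric(Z) = h + k quantifies over orthonormal complements of Z; deducing the Killing
    property from it takes at least one. *)
Lemma reeb_complement_exists p : chart_dom a p ->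
  exists e, orthonormal_complement g a p (Z a p) e.
Proof.
move=> pa; have Ux := coord_image pa.
have Gx : G (coord a p) = g a p by rewrite /G /= (coordK pa).
have [|e [eo ze]] := orthonormal_exists (Z a p) (gT Ux) (gpos Ux) (m := N.-1).
  by rewrite ltn_predL addnS.
by exists e; rewrite /orthonormal_complement -Gx; split.
Qed.

End MetricContactPair.

Unset Implicit Arguments.

Theorem theorem4p2 (R : realType) (h k : nat)
  (M : manifold R (2 * h + 2 * k + 2))
  (al1 al2 : chart M -> M -> 'cV[R]_(2 * h + 2 * k + 2))
  (Z1 Z2 : chart M -> M -> 'rV[R]_(2 * h + 2 * k + 2))
  (phi g : chart M -> M -> 'M[R]_(2 * h + 2 * k + 2))
  (mcp : metric_contact_pair al1 al2 Z1 Z2 phi g)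
  (dec : decomposable al1 al2 phi) :
  let Z := fun a p => Z1 a p + Z2 a p in
  let hh := fun a p => 2^-1 *: lie_endo Z phi a p in
  (forall a p e, chart_dom a p -> orthonormal_complement g a p (Z a p) e ->
     ricci_direction g a p (Z a p) e =
       h%:R + k%:R - 2^-1 * \tr (hh a p *m hh a p)) /\
  ((forall a p e, chart_dom a p -> orthonormal_complement g a p (Z a p) e ->
      ricci_direction g a p (Z a p) e = h%:R + k%:R) <->
   killing g Z).
Proof.
move=> Z hh.
have ricci a p e : chart_dom a p -> orthonormal_complement g a p (Z a p) e ->
    ricci_direction g a p (Z a p) e =
      h%:R + k%:R - 2^-1 * \tr (hh a p *m hh a p).
  by move=> pa pe; exact: (ricci_direction_reeb mcp pa pe).
split; first exact: ricci.
split=> [flat a p pa|kill a p e pa pe].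
  have [e pe] := reeb_complement_exists mcp pa.
  apply/(half_lie_endo_sqr_eq0 mcp pa).
  have := ricci _ _ _ pa pe; rewrite (flat _ _ _ pa pe) => /eqP.
  rewrite -subr_eq0 opprB addrC subrK mulf_eq0 invr_eq0 pnatr_eq0 /=.
  by move/eqP.
rewrite (ricci _ _ _ pa pe).
have -> : \tr (hh a p *m hh a p) = 0.
  by apply/(half_lie_endo_sqr_eq0 mcp pa); exact: kill.
by rewrite mulr0 subr0.
Qed.
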